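(* Let $\ell,n\in\mathbb{R}$ be fixed with $\ell\le-\frac12$ and $n\in-\ell+\mathbb{N}_0$. Then $$\sup\Bigl\{\ \Bigl|\,\mathcal{P}_{mn}^{\ell}(x)-\frac{(-1)^{m-n}}{\bigl(m\,(\ell+n)!\,\Gamma(n-\ell)\bigr)^{\frac12}}\,W_{n,\,\ell+\frac12}\Bigl(\frac{2m}{x}\Bigr)\Bigr|\;x^{\frac12}\,m^{2}\ :\ x\in\mathbb{R},\ x\ge1,\ m\in n+\mathbb{N}_0\ \Bigr\}$$ is finite.
   Context: $\mathbb{N}_0=\{0,1,2,\dots\}$. For $\ell\in\mathbb{C}$, $m,n\in\mathbb{R}$ with $m-n\in\mathbb{N}_0$ and $x\ge1$, $$\mathfrak{P}_{mn}^{\ell}(x)=\binom{\ell-n}{m-n}\Bigl(\frac{x-1}2\Bigr)^{\frac{m-n}2}\Bigl(\frac{x+1}2\Bigr)^{-\frac{m+n}2}\,{}_2F_1\bigl(-\ell-n,\ \ell+1-n;\ m-n+1;\ \tfrac{1-x}2\bigr),$$ where ${}_2F_1$ is the Gaussian hypergeometric function (analytically continued to $\mathbb{C}\setminus[1,\infty[$), $\binom{a}{k}=\frac{a(a-1)\cdots(a-k+1)}{k!}$ for $k\in\mathbb{N}_0$, and $0^0=1$. For $\ell<0$ real and $m,n\in-\ell+\mathbb{N}_0$ with $m-n\in\mathbb{N}_0$, the discrete series coefficient is $$\mathcal{P}_{mn}^{\ell}(x)=\Bigl(\frac{\Gamma(-\ell+n)\,\Gamma(\ell+m+1)}{\Gamma(-\ell+m)\,\Gamma(\ell+n+1)}\Bigr)^{\frac12}\,\mathfrak{P}_{mn}^{\ell}(x).$$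 Whittaker function: for $\mathrm{Re}\,z>0$ and $\mathrm{Re}(\rho-\nu+\frac12)>0$, $$W_{\nu,\rho}(z)=\frac{z^{\rho+\frac12}e^{-z/2}}{\Gamma(\rho-\nu+\frac12)}\int_0^\infty e^{-zu}\,u^{\rho-\nu-\frac12}(1+u)^{\rho+\nu-\frac12}\,du ,$$ extended by analytic continuation to all $\nu,\rho\in\mathbb{C}$ and $z\in\mathbb{C}\setminus\,]-\infty,0]$. *)

(* Defs.v *)
From Stdlib Require Import Reals Factorial ClassicalEpsilon.
From Coquelicot Require Import Coquelicot.

Open Scope R_scope.

(** * Complex exponential, powers and the Gamma function *)

Definition Cexp (z : C) : C :=
  (exp (Re z) * cos (Im z), exp (Re z) * sin (Im z)).

(* The principal logarithm, on the half-plane [0 < Re z] only. *)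
Definition Clog (z : C) : C := (ln (Cmod z), atan (Im z / Re z)).

Definition Cpower (z s : C) : C := Cexp (s * Clog z)%C.

Definition CInt_0_infty (f : R -> C) : C :=
  @RInt_gen C_R_CompleteNormedModule f (at_right 0) (Rbar_locally p_infty).

(* Euler's integral: this is the Gamma function for [0 < Re s] only. *)
Definition Gamma (s : C) : C :=
  CInt_0_infty (fun t => Cexp (- RtoC t) * Cpower (RtoC t) (s - 1))%C.

(* Gamma is real on positive reals. *)
Definition RGamma (s : R) : R := Re (Gamma (RtoC s)).

(** * Analytic functions of one and of three complex variables *)

Definition analytic_at (F : C -> C) (z0 : C) : Prop :=
  exists (a : nat -> C) (r : R), 0 < r /\
    forall h : C, Cmod h < r ->
      @is_pseries C_AbsRing C_NormedModule a h (F (z0 + h)%C).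

(* [F] is near the point the sum of an absolutely convergent triple power
   series; the monomials are grouped by their total degree. *)
Definition monomial3 (a : nat -> nat -> nat -> C) (h1 h2 h3 : C)
    (N i j : nat) : C :=
  (a i j (N - i - j)%nat * h1 ^ i * h2 ^ j * h3 ^ (N - i - j))%C.

Definition analytic3_at (F : C -> C -> C -> C) (z1 z2 z3 : C) : Prop :=
  exists (a : nat -> nat -> nat -> C) (r : R), 0 < r /\
    forall h1 h2 h3 : C, Cmod h1 < r -> Cmod h2 < r -> Cmod h3 < r ->
      ex_series (fun N => sum_n (fun i =>
        sum_n (fun j => Cmod (monomial3 a h1 h2 h3 N i j)) (N - i)) N) /\
      @is_series C_AbsRing C_NormedModule
        (fun N => sum_n (fun i =>
           sum_n (fun j => monomial3 a h1 h2 h3 N i j) (N - i)) N)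
        (F (z1 + h1)%C (z2 + h2)%C (z3 + h3)%C).

(** * The Gaussian hypergeometric function *)

Fixpoint Cpoch (a : C) (k : nat) : C :=
  match k with
  | O => 1%C
  | S k => (Cpoch a k * (a + INR k))%C
  end.

Definition hyp2F1_coeff (a b c : C) (k : nat) : C :=
  (Cpoch a k * Cpoch b k / (Cpoch c k * INR (fact k)))%C.

(* [F] is the analytic continuation to the complement of [1, +oo[ of the
   hypergeometric series. *)
Definition is_hyp2F1 (a b c : C) (F : C -> C) : Prop :=
  (forall z, Cmod z < 1 ->
     @is_pseries C_AbsRing C_NormedModule (hyp2F1_coeff a b c) z (F z)) /\
  (forall z, ~ (Im z = 0 /\ 1 <= Re z) -> analytic_at F z).

(* Determined on the complement of [1, +oo[ when [c] is not in -N. *)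
Definition hyp2F1 (a b c : C) : C -> C :=
  epsilon (inhabits (fun _ => RtoC 0)) (is_hyp2F1 a b c).

(** * The functions P *)

Fixpoint Cffact (a : C) (k : nat) : C :=
  match k with
  | O => 1%C
  | S k => (Cffact a k * (a - INR k))%C
  end.

Definition Cbinom (a : C) (k : nat) : C := (Cffact a k / INR (fact k))%C.

(* Real powers of a nonnegative base with 0^0 = 1, and 0^b = 0 for 0 < b;
   the standard [Rpower 0 b] is always 1. *)
Definition Rpow0 (a b : R) : R :=
  if Req_EM_T a 0 then (if Req_EM_T b 0 then 1 else 0) else Rpower a b.

(* In both functions the index [m] is [n + j], that is, [j = m - n]. *)
Definition frakP (l : C) (n : R) (j : nat) (x : R) : C :=
  let m := n + INR j in
  (Cbinom (l - n) j
   * Rpow0 ((x - 1) / 2) ((m - n) / 2)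
   * Rpow0 ((x + 1) / 2) (- ((m + n) / 2))
   * hyp2F1 (- l - n) (l + 1 - n) (RtoC (m - n + 1)) (RtoC ((1 - x) / 2)))%C.

Definition calP (l n : R) (j : nat) (x : R) : C :=
  let m := n + INR j in
  (sqrt (RGamma (- l + n) * RGamma (l + m + 1)
         / (RGamma (- l + m) * RGamma (l + n + 1)))
   * frakP (RtoC l) n j x)%C.

(** * The Whittaker function *)

Definition Whittaker_integral (nu rho z : C) : C :=
  (Cpower z (rho + / 2) * Cexp (- z / 2) / Gamma (rho - nu + / 2)
   * CInt_0_infty (fun u => Cexp (- (z * u))
       * Cpower (RtoC u) (rho - nu - / 2)
       * Cpower (RtoC (1 + u)) (rho + nu - / 2)))%C.

(* [W nu rho z] is the analytic continuation of the integral to all complex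
   [nu], [rho] and to [z] off the half-line ]-oo, 0].  The domain is connected,
   so this determines [W] there; elsewhere [W] is arbitrary. *)
Definition is_Whittaker (W : C -> C -> C -> C) : Prop :=
  (forall nu rho z, 0 < Re z -> 0 < Re (rho - nu + / 2)%C ->
     W nu rho z = Whittaker_integral nu rho z) /\
  (forall nu rho z, ~ (Im z = 0 /\ Re z <= 0) -> analytic3_at W nu rho z).

(* Main.v *)
Require Import Defs.
From Stdlib Require Import Reals Factorial Lra Lia Psatz ClassicalEpsilon.
From Coquelicot Require Import Coquelicot.

Open Scope R_scope.

(** Put [al = - 2 l - 1 >= 0], [m = n + j], [z = 2 m / x], so that [n = (al + 1) / 2 + k].
    Both functions are elementary, with the same coefficients
    [c_i = binom(k, i) (- al - k)_i], [i <= k].  The hypergeometric series terminates because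
    its first parameter is [- k]; and on the line [rho + nu - 1/2 = k] the Whittaker integrand
    is [e^(- z u) u^(a - 1) (1 + u)^k] with [a = rho - nu + 1/2], so that the integral is
    elementary for [a > 0] and continues analytically in [a] to the required [a = - al - k], giving
    [W = e^(- z / 2) sum_i c_i z^(n - i)].  Up to the common factor
    [(-1)^j / sqrt (k! Gamma(n - l))], the [i]-th term of [P] is
    [c_i m^(- 1/2) e^(- z / 2) z^(n - i) (1 + r_i / m - i / x + O((1 + z)^3 / m^2))] with
    [r_i = - (k - i) (al + k - i) / 2], where [1 / x = z / (2 m)].  The corrections of order
    [1 / m] do not vanish term by term, but their sum over [i] telescopes to [0] by the recurrence
    [(i + 1) c_(i + 1) = (k - i) (- al - k + i) c_i].  Since [n - i >= 1/2], the remaining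
    error is at most a constant times [m^(- 5/2) sqrt z]. *)

(** * The Gamma function on the positive reals *)

(** The estimate must be uniform in [x >= 1], although [m / x] ranges from near 0 up to [m]. All
    errors are therefore measured in the single unit (1 + z)^3 / m^2, which the factor e^(- z / 2)
    absorbs; the cube comes from the exponent of the algebraic prefactor, whose error is of order 1
    / x^2 + m / x^3. The correction r_i / m is obtained without Stirling's formula. A convexity
    inequality gives only the leading behaviour of Gamma (a + j), hence that the logarithm of the
    normalized Gamma quotient tends to 0. By the functional equation the increments of this
    logarithm, after removal of r_i / m, are of order m^-3, and summing them from infinity gives the
    error m^-2. Both analytic continuations are needed at real points only and are reached along
    real segments, so an identity theorem in one real variable is enough. The Whittaker formula
    passes the poles of Gamma because Gamma (a + i) / Gamma (a) is a polynomial in a. *)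

Lemma exp_ge_pow (N : nat) (x : R) : 0 <= x -> x ^ N / INR (fact N) <= exp x.
Proof.
intros Hx.
assert (E := is_exp_Reals x). apply is_pseries_R in E.
assert (Hp : forall n, 0 <= / INR (fact n) * x ^ n).
{ intros n; apply Rmult_le_pos; [left; apply Rinv_0_lt_compat, INR_fact_lt_0 | now apply pow_le]. }
apply is_series_unique in E as E'.
rewrite <- E', (Series_incr_n _ (S N)); [|lia|eexists; exact E].
simpl pred. rewrite <- sum_n_Reals.
assert (0 <= Series (fun k => / INR (fact (S N + k)) * x ^ (S N + k))).
{ rewrite <- (Rmult_0_l (Series (fun k => / INR (fact (S N + k)) * x ^ (S N + k)))).
  rewrite <- Series_scal_l.
  apply Series_le.
  - intros n; specialize (Hp (S N + n)%nat); lra.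
  - apply -> (ex_series_incr_n (fun k => / INR (fact k) * x ^ k) (S N)).
    eexists; exact E. }
assert (forall M, 0 <= sum_n (fun n => / INR (fact n) * x ^ n) M).
{ intros M; rewrite sum_n_Reals; apply cond_pos_sum; auto. }
destruct N.
- rewrite sum_O. simpl in *. lra.
- rewrite sum_Sn. unfold plus; simpl plus in *. specialize (H0 N).
  unfold Rdiv. rewrite (Rmult_comm (x ^ S N)).
  change (AbelianMonoid.plus _ _) with (fun a b : R => a + b). lra.
Qed.

Lemma pow_exp_bounded (N : nat) (c : R) : 0 < c ->
  exists K, 0 < K /\ forall t, 0 <= t -> (1 + t) ^ N * exp (- (c * t)) <= K.
Proof.
(* The constant results from solving [(c * (1 + t)) ^ N / INR (fact N) <= exp (c + c * t)] for
   [(1 + t) ^ N]. *)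
intros Hc. exists (INR (fact N) / c ^ N * exp c).
assert (0 < c ^ N) by now apply pow_lt.
assert (F := INR_fact_lt_0 N).
split.
{ apply Rmult_lt_0_compat; [apply Rdiv_lt_0_compat; auto | apply exp_pos]. }
intros t Ht.
assert (E := exp_ge_pow N (c * (1 + t)) ltac:(nra)).
rewrite Rpow_mult_distr in E.
replace (c * (1 + t)) with (c + c * t) in E by ring. rewrite exp_plus in E.
assert (P := exp_pos (- (c * t))).
replace (exp c) with (exp c * exp (c * t) * exp (- (c * t))).
2:{ rewrite Rmult_assoc, <- exp_plus, Rplus_opp_r, exp_0; ring. }
rewrite <- Rmult_assoc. apply Rmult_le_compat_r; [lra|].
apply (Rmult_le_reg_l (c ^ N / INR (fact N))).
{ apply Rdiv_lt_0_compat; auto. }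
replace (c ^ N / INR (fact N) * (1 + t) ^ N) with (c ^ N * (1 + t) ^ N / INR (fact N)) by (field; lra).
replace (c ^ N / INR (fact N) * (INR (fact N) / c ^ N * (exp c * exp (c * t)))) with (exp c * exp (c * t)) by (field; lra).
exact E.
Qed.

Lemma Rpower_le_pow (s : R) : 0 <= s ->
  exists N : nat, forall t, 0 < t -> Rpower t s <= (1 + t) ^ N.
Proof.
intros Hs. destruct (nfloor_ex s Hs) as [N HN]. exists (S N).
intros u Hu.
apply Rle_trans with (Rpower (1 + u) s).
- apply Rle_Rpower_l; lra.
- rewrite <- Rpower_pow, S_INR by lra. apply Rle_Rpower; lra.
Qed.

Lemma exp_Rpower_bounded (c s : R) : 0 < c -> 0 <= s ->
  exists K, 0 < K /\ forall t, 0 < t -> exp (- (c * t)) * Rpower t s <= K.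
Proof.
intros Hc Hs. destruct (Rpower_le_pow s Hs) as (N & HN).
destruct (pow_exp_bounded N c Hc) as (K & HK & H). exists K; split; auto.
intros t Ht. apply Rle_trans with (2 := H t ltac:(lra)).
rewrite Rmult_comm. apply Rmult_le_compat_r; [left; apply exp_pos | auto].
Qed.

Lemma filter_prod_0_infty (P : R -> R -> Prop) (a0 b0 : R) : 0 < a0 ->
  (forall a b, 0 < a < a0 -> b0 < b -> P a b) ->
  filter_prod (at_right 0) (Rbar_locally p_infty) (fun ab => P (fst ab) (snd ab)).
Proof.
intros Ha HP.
apply (Filter_prod _ _ _ (fun a => 0 < a < a0) (fun b => b0 < b)).
- exists (mkposreal a0 Ha); intros y Hy Hy'.
  unfold ball in Hy; simpl in Hy; unfold AbsRing_ball, abs, minus, plus, opp in Hy; simpl in Hy.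
  apply Rabs_def2 in Hy. lra.
- exists b0; auto.
- intros; apply HP; auto.
Qed.

(** The integrals of a nonnegative function grow with the interval, so their supremum is the
    improper integral. The second conclusion serves to show that Gamma is positive. *)
Lemma is_RInt_gen_bounded (f : R -> R) (M : R) :
  (forall t, 0 < t -> continuous f t) -> (forall t, 0 < t -> 0 <= f t) ->
  (forall a b, 0 < a < b -> RInt f a b <= M) ->
  exists l, is_RInt_gen f (at_right 0) (Rbar_locally p_infty) l /\
    forall a b, 0 < a < b -> RInt f a b <= l.
Proof.
intros Hc Hp HM.
set (E := fun y => exists a b, 0 < a < b /\ y = RInt f a b).
destruct (completeness E) as [l [Hub Hl]].
{ exists M. intros y (a & b & H & ->). auto. }
{ exists (RInt f 1 2), 1, 2. split; [lra|auto]. }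
assert (Hex : forall a b, 0 < a -> 0 < b -> ex_RInt f a b).
{ intros a b Ha Hb. apply (ex_RInt_continuous (V := R_CompleteNormedModule)). intros z Hz. apply Hc.
  apply Rlt_le_trans with (2 := proj1 Hz). now apply Rmin_pos. }
exists l; split.
2:{ intros a b H; apply Hub. exists a, b; auto. }
intros P [eps HP].
destruct (classic (exists a b, 0 < a < b /\ l - eps < RInt f a b)) as [(a0 & b0 & H0 & H1)|N].
2:{ exfalso. assert (l <= l - eps).
    { apply Hl. intros y (a & b & H & ->). apply Rnot_lt_le. intros H'. apply N. exists a, b; auto. }
    destruct eps; simpl in *; lra. }
unfold filtermapi.
apply (filter_prod_0_infty (fun a b => exists l' : R, is_RInt f a b l' /\ P l') a0 b0); [lra|].
intros a b Ha Hb. exists (RInt f a b). split.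
{ apply (RInt_correct (V := R_CompleteNormedModule)), Hex; lra. }
apply HP.
assert (RInt f a b <= l) by (apply Hub; exists a, b; split; [lra|auto]).
assert (RInt f a b >= RInt f a0 b0).
{ rewrite <- (RInt_Chasles f a a0 b) by (apply Hex; lra).
  rewrite <- (RInt_Chasles f a0 b0 b) by (apply Hex; lra).
  assert (0 <= RInt f a a0) by (apply RInt_ge_0; [lra|apply Hex; lra|intros; apply Hp; lra]).
  assert (0 <= RInt f b0 b) by (apply RInt_ge_0; [lra|apply Hex; lra|intros; apply Hp; lra]).
  unfold plus; simpl. lra. }
unfold ball; simpl; unfold AbsRing_ball, abs, minus, plus, opp; simpl.
apply Rabs_def1; destruct eps; simpl in *; lra.
Qed.

Lemma is_RInt_gen_0_infty_unique (f : R -> R) (l l' : R) :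
  is_RInt_gen f (at_right 0) (Rbar_locally p_infty) l ->
  is_RInt_gen f (at_right 0) (Rbar_locally p_infty) l' -> l = l'.
Proof.
intros H H'.
rewrite <- (is_RInt_gen_unique (V := R_CompleteNormedModule) f l H).
exact (is_RInt_gen_unique (V := R_CompleteNormedModule) f l' H').
Qed.

Lemma filterlim_at_right_continuous (f : R -> R) (x : R) :
  continuous f x -> filterlim f (at_right x) (locally (f x)).
Proof. intros H P HP. destruct (H P HP) as [e He]. exists e. auto. Qed.

(** Euler's integrand for [z = 1]; the general [z] is what the Whittaker integral produces. *)
Definition gint (z s t : R) : R := exp (- (z * t)) * Rpower t (s - 1).

Lemma gint_continuous (z s t : R) : 0 < t -> continuous (gint z s) t.
Proof.
intros Ht. apply (ex_derive_continuous (K := R_AbsRing) (V := R_NormedModule)).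
unfold gint, Rpower. auto_derive. lra.
Qed.

Lemma gint_pos (z s t : R) : 0 < gint z s t.
Proof. apply Rmult_lt_0_compat; apply exp_pos. Qed.

(* [K * (- 1 / (1 + t ^ s))] has a derivative dominating the integrand. *)
Lemma ex_gint (z s : R) : 0 < z -> 0 < s ->
  exists l, is_RInt_gen (gint z s) (at_right 0) (Rbar_locally p_infty) l /\ 0 < l.
Proof.
intros Hz Hs.
destruct (exp_Rpower_bounded (z / 2) s ltac:(lra) ltac:(lra)) as (K & HK & H).
(* Half of the exponential goes to each factor of the square:
   [exp (- (z * t)) * (1 + Rpower t s) ^ 2] is the square of
   [exp (- (z / 2 * t)) * (1 + Rpower t s)], which is at most [1 + K]. Dividing by [s] compensates
   the derivative of [Rpower t s]. *)
set (K' := (1 + K) ^ 2 / s).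
assert (HB : forall t, 0 < t -> gint z s t <= K' * (s * Rpower t (s - 1) / (1 + Rpower t s) ^ 2)).
{ intros t Ht. unfold gint. specialize (H t Ht).
  assert (E1 : exp (- (z * t)) = exp (- (z / 2 * t)) * exp (- (z / 2 * t))).
  { rewrite <- exp_plus; f_equal; field. }
  assert (P := exp_pos (- (z / 2 * t))).
  assert (exp (- (z / 2 * t)) < 1).
  { rewrite <- exp_0. apply exp_increasing. assert (0 < z / 2 * t) by (apply Rmult_lt_0_compat; lra). lra. }
  assert (Q : 0 < Rpower t s) by apply exp_pos.
  assert (Q' : 0 < Rpower t (s - 1)) by apply exp_pos.
  replace (K' * (s * Rpower t (s - 1) / (1 + Rpower t s) ^ 2)) with ((1 + K) ^ 2 / (1 + Rpower t s) ^ 2 * Rpower t (s - 1)).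
  2:{ unfold K'. field. split; lra. }
  apply Rmult_le_compat_r; [lra|].
  apply (Rmult_le_reg_r ((1 + Rpower t s) ^ 2)); [nra|].
  replace ((1 + K) ^ 2 / (1 + Rpower t s) ^ 2 * (1 + Rpower t s) ^ 2) with ((1 + K) ^ 2) by (field; lra).
  rewrite E1.
  replace (exp (- (z / 2 * t)) * exp (- (z / 2 * t)) * (1 + Rpower t s) ^ 2) with ((exp (- (z / 2 * t)) + exp (- (z / 2 * t)) * Rpower t s) ^ 2) by ring.
  apply pow_incr. split; [|lra].
  assert (0 < exp (- (z / 2 * t)) * Rpower t s) by now apply Rmult_lt_0_compat.
  lra. }
assert (HD : forall t, 0 < t -> is_derive (fun t => K' * - / (1 + Rpower t s)) t (K' * (s * Rpower t (s - 1) / (1 + Rpower t s) ^ 2))).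
{ intros t Ht. assert (Q : 0 < exp (s * ln t)) by apply exp_pos. unfold Rpower. auto_derive; [lra|].
  replace ((s - 1) * ln t) with (s * ln t + - ln t) by ring. rewrite exp_plus, exp_Ropp, exp_ln by lra.
  field. split; lra. }
assert (K'pos : 0 < K').
{ unfold K'. apply Rdiv_lt_0_compat; [apply pow_lt; lra | lra]. }
destruct (is_RInt_gen_bounded (gint z s) K') as (l & Hl & Hl').
- intros; now apply gint_continuous.
- intros; left; apply gint_pos.
- intros a b Hab.
  assert (I : is_RInt (fun t => K' * (s * Rpower t (s - 1) / (1 + Rpower t s) ^ 2)) a b
     (minus (K' * - / (1 + Rpower b s)) (K' * - / (1 + Rpower a s)))).
  { apply (is_RInt_derive (fun t => K' * - / (1 + Rpower t s))).
    - intros x Hx. apply HD. rewrite Rmin_left in Hx; lra.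
    - intros x Hx. rewrite Rmin_left in Hx by lra.
      apply (ex_derive_continuous (K := R_AbsRing) (V := R_NormedModule)).
      assert (Q : 0 < exp (s * ln x)) by apply exp_pos.
      unfold Rpower. auto_derive. repeat split; lra || nra. }
  apply Rle_trans with (minus (K' * - / (1 + Rpower b s)) (K' * - / (1 + Rpower a s))).
  + rewrite <- (is_RInt_unique _ _ _ _ I). apply RInt_le.
    * lra.
    * apply (ex_RInt_continuous (V := R_CompleteNormedModule)). intros x Hx. rewrite Rmin_left in Hx by lra. apply gint_continuous; lra.
    * eexists; exact I.
    * intros x Hx. apply HB; lra.
  + unfold minus, plus, opp; simpl.
    assert (Qa : 0 < Rpower a s) by apply exp_pos.
    assert (Qb : 0 < Rpower b s) by apply exp_pos.
    assert (0 < / (1 + Rpower b s)) by (apply Rinv_0_lt_compat; lra).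
    assert (/ (1 + Rpower a s) <= / 1) by (apply Rinv_le_contravar; lra).
    rewrite Rinv_1 in *. nra.
- exists l; split; auto.
  apply Rlt_le_trans with (2 := Hl' 1 2 ltac:(lra)).
  apply RInt_gt_0; [lra| |].
  + intros; apply gint_pos.
  + intros; apply gint_continuous; lra.
Qed.

Lemma is_RInt_gen_scale (f : R -> R) (z l : R) : 0 < z ->
  is_RInt_gen f (at_right 0) (Rbar_locally p_infty) l ->
  is_RInt_gen (fun u => z * f (z * u)) (at_right 0) (Rbar_locally p_infty) l.
Proof.
intros Hz H P HP. specialize (H P HP). unfold filtermapi in *.
destruct H as [Q1 Q2 [e He] [M HM] H].
apply (filter_prod_0_infty (fun a b => exists l' : R, is_RInt (fun u => z * f (z * u)) a b l' /\ P l') (e / z) (M / z)).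
{ apply Rdiv_lt_0_compat; [apply cond_pos | auto]. }
intros a b Ha Hb.
assert (za : 0 < z * a < e).
{ split; [apply Rmult_lt_0_compat; lra|]. destruct Ha as [_ Ha]. apply (Rmult_lt_compat_l z) in Ha; auto.
  replace (z * (e / z)) with (pos e) in Ha by (field; lra). lra. }
destruct (H (z * a) (z * b)) as (l' & I & Hl').
- apply He; [|lra]. unfold ball; simpl; unfold AbsRing_ball, abs, minus, plus, opp; simpl.
  apply Rabs_def1; lra.
- apply HM. apply (Rmult_lt_compat_l z) in Hb; auto.
  replace (z * (M / z)) with M in Hb by (field; lra). auto.
- exists l'; split; auto. simpl in I.
  assert (J := is_RInt_comp_lin f z 0 a b l'). rewrite !Rplus_0_r in J. specialize (J I).
  eapply is_RInt_ext; [|exact J]. intros x _. simpl. now rewrite Rplus_0_r.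
Qed.


Lemma Rpower_lim_0 (s : R) : 0 < s ->
  filterlim (fun t => Rpower t s) (at_right 0) (locally 0).
Proof.
intros Hs P [eps HP].
exists (mkposreal (Rpower eps (/ s)) (exp_pos _)).
intros t Ht Ht0. apply HP.
unfold ball in *; simpl in *; unfold AbsRing_ball, abs, minus, plus, opp in *; simpl in *.
rewrite Ropp_0, Rplus_0_r in *. rewrite Rabs_right in Ht by lra.
rewrite Rabs_right by (left; apply exp_pos).
replace (pos eps) with (Rpower (Rpower eps (/ s)) s).
- apply Rlt_Rpower_l; lra.
- rewrite Rpower_mult, Rinv_l, Rpower_1; [auto|apply cond_pos|lra].
Qed.

Lemma exp_lim_infty (c : R) : 0 < c ->
  filterlim (fun t => exp (- (c * t))) (Rbar_locally p_infty) (locally 0).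
Proof.
intros Hc P [eps HP]. exists (Rmax 0 (/ (c * eps))). intros t Ht. apply HP.
assert (He := cond_pos eps).
assert (0 < t) by (apply Rle_lt_trans with (2 := Ht), Rmax_l).
assert (/ (c * eps) < t) by (apply Rle_lt_trans with (2 := Ht), Rmax_r).
unfold ball; simpl; unfold AbsRing_ball, abs, minus, plus, opp; simpl.
rewrite Ropp_0, Rplus_0_r, Rabs_right by (left; apply exp_pos).
rewrite exp_Ropp. assert (0 < c * t) by (apply Rmult_lt_0_compat; lra).
assert (E := exp_ineq1 (c * t) ltac:(lra)).
apply (Rmult_lt_compat_l (c * eps)) in H0; [|apply Rmult_lt_0_compat; lra].
rewrite Rinv_r in H0 by (apply Rgt_not_eq, Rmult_lt_0_compat; lra).
apply (Rmult_lt_reg_r (exp (c * t))); [apply exp_pos|].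
rewrite Rinv_l by (apply Rgt_not_eq, exp_pos). nra.
Qed.

Lemma exp_Rpower_lim_infty (s : R) : 0 <= s ->
  filterlim (fun t => exp (- t) * Rpower t s) (Rbar_locally p_infty) (locally 0).
Proof.
intros Hs. destruct (exp_Rpower_bounded (/ 2) s ltac:(lra) Hs) as (K & HK & H).
apply (filterlim_le_le (fun _ => 0) _ (fun t => exp (- (/ 2 * t)) * K) (Finite 0)).
- exists 0. intros t Ht. split.
  + left; apply Rmult_lt_0_compat; apply exp_pos.
  + replace (- t) with (- (/ 2 * t) + - (/ 2 * t)) by field. rewrite exp_plus, Rmult_assoc.
    apply Rmult_le_compat_l; auto. left; apply exp_pos.
- apply filterlim_const.
- change (filterlim (fun t => exp (- (/ 2 * t)) * K) (Rbar_locally p_infty) (locally 0)). rewrite <- (Rmult_0_l K).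
  apply (filterlim_comp _ _ _ (fun t => exp (- (/ 2 * t))) (fun y => y * K) _ (locally 0)).
  + apply exp_lim_infty; lra.
  + apply (continuous_mult (K := R_AbsRing) (fun y => y) (fun _ => K)); [apply continuous_id|apply continuous_const].
Qed.

Lemma is_RInt_gen_derive_pos (F f : R -> R) (la lb : R) :
  (forall t, 0 < t -> is_derive F t (f t)) -> (forall t, 0 < t -> continuous f t) ->
  filterlim F (at_right 0) (locally la) -> filterlim F (Rbar_locally p_infty) (locally lb) ->
  is_RInt_gen f (at_right 0) (Rbar_locally p_infty) (lb - la).
Proof.
intros HD Hc Ha Hb.
apply (is_RInt_gen_ext (Derive F)).
- apply (filter_prod_0_infty (fun a b => forall x, Rmin a b < x < Rmax a b -> Derive F x = f x) 1 0); [lra|].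
  intros a b H H0 x Hx. apply is_derive_unique, HD.
  apply Rlt_trans with (2 := proj1 Hx). apply Rmin_pos; lra.
- apply is_RInt_gen_Derive; auto.
  + apply (filter_prod_0_infty (fun a b => forall x, Rmin a b <= x <= Rmax a b -> ex_derive F x) 1 0); [lra|].
    intros a b H H0 x Hx. eexists; apply HD.
    apply Rlt_le_trans with (2 := proj1 Hx). apply Rmin_pos; lra.
  + apply (filter_prod_0_infty (fun a b => forall x, Rmin a b <= x <= Rmax a b -> continuous (Derive F) x) 1 0); [lra|].
    intros a b H H0 x Hx.
    assert (0 < x) by (apply Rlt_le_trans with (2 := proj1 Hx); apply Rmin_pos; lra).
    apply (continuous_ext_loc _ f); [|auto].
    exists (mkposreal x H1). intros y Hy.
    unfold ball in *; simpl in *; unfold AbsRing_ball, abs, minus, plus, opp in *; simpl in *.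
    apply Rabs_def2 in Hy. symmetry. apply is_derive_unique, HD. lra.
Qed.

(** * Complex integrals with real integrands, and the functional equation of Gamma *)

Lemma Clog_RtoC (t : R) : 0 < t -> Clog (RtoC t) = RtoC (ln t).
Proof.
intros Ht. unfold Clog, RtoC; simpl. f_equal.
- f_equal. change (Cmod (RtoC t) = t). rewrite Cmod_R, Rabs_right; lra.
- rewrite Rdiv_0_l. apply atan_0.
Qed.

Lemma Cexp_RtoC (x : R) : Cexp (RtoC x) = RtoC (exp x).
Proof. unfold Cexp, RtoC; simpl. rewrite cos_0, sin_0, Rmult_1_r, Rmult_0_r. reflexivity. Qed.

Lemma Cpower_RtoC (t s : R) : 0 < t -> Cpower (RtoC t) (RtoC s) = RtoC (Rpower t s).
Proof. intros Ht. unfold Cpower. rewrite Clog_RtoC, <- RtoC_mult, Cexp_RtoC by auto. reflexivity. Qed.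

Lemma CInt_0_infty_RtoC (f : R -> C) (g : R -> R) (l : R) :
  (forall t, 0 < t -> f t = RtoC (g t)) ->
  is_RInt_gen g (at_right 0) (Rbar_locally p_infty) l ->
  CInt_0_infty f = RtoC l.
Proof.
intros Hf Hg. unfold CInt_0_infty. apply (is_RInt_gen_unique (V := C_R_CompleteNormedModule)).
apply (is_RInt_gen_ext (V := C_R_NormedModule) (fun t => RtoC (g t))).
{ apply (filter_prod_0_infty (fun a b => forall x, Rmin a b < x < Rmax a b -> RtoC (g x) = f x) 1 0); [lra|].
  intros a b H H0 x Hx. symmetry. apply Hf.
  apply Rlt_trans with (2 := proj1 Hx). apply Rmin_pos; lra. }
intros P HP.
assert (HP' : locally l (fun y => P (RtoC y))).
{ destruct HP as [e He]. exists e. intros y Hy. apply He. split; [exact Hy|apply ball_center]. }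
specialize (Hg _ HP'). unfold filtermapi in *. revert Hg. apply filter_imp.
intros [a b] (y & I & Hy). exists (RtoC y). split; [|exact Hy].
apply (is_RInt_fct_extend_pair (U := R_NormedModule) (V := R_NormedModule)).
- exact I.
- simpl. assert (J := is_RInt_const (V := R_NormedModule) a b 0).
  rewrite (@scal_zero_r R_AbsRing R_NormedModule) in J. exact J.
Qed.

Lemma RGamma_correct (s : R) : 0 < s ->
  is_RInt_gen (gint 1 s) (at_right 0) (Rbar_locally p_infty) (RGamma s) /\
  Gamma (RtoC s) = RtoC (RGamma s) /\ 0 < RGamma s.
Proof.
intros Hs. destruct (ex_gint 1 s ltac:(lra) Hs) as (l & Hl & Hp).
assert (E : Gamma (RtoC s) = RtoC l).
{ unfold Gamma. apply CInt_0_infty_RtoC with (2 := Hl). intros t Ht.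
  rewrite <- RtoC_opp, <- RtoC_minus, Cexp_RtoC, Cpower_RtoC, <- RtoC_mult by auto.
  unfold gint. rewrite Rmult_1_l. reflexivity. }
unfold RGamma. rewrite E. simpl. auto.
Qed.

Lemma RGamma_pos (s : R) : 0 < s -> 0 < RGamma s.
Proof. apply RGamma_correct. Qed.

Lemma is_RInt_gen_gint (z s : R) : 0 < z -> 0 < s ->
  is_RInt_gen (gint z s) (at_right 0) (Rbar_locally p_infty) (Rpower z (- s) * RGamma s).
Proof.
intros Hz Hs. destruct (RGamma_correct s Hs) as [I _].
apply is_RInt_gen_scale with (1 := Hz) in I.
apply (is_RInt_gen_scal _ (Rpower z (- s))) in I.
eapply is_RInt_gen_ext; [|exact I].
apply (filter_prod_0_infty (fun a b => forall x, Rmin a b < x < Rmax a b -> scal (Rpower z (-s)) (z * gint 1 s (z * x)) = gint z s x) 1 0); [lra|].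
intros a b H H0 x Hx.
assert (0 < x) by (apply Rlt_trans with (2 := proj1 Hx); apply Rmin_pos; lra).
unfold gint, scal; simpl; unfold mult; simpl.
rewrite Rmult_1_l, <- Rpower_mult_distr by auto.
replace (Rpower z (- s) * (z * (exp (- (z * x)) * (Rpower z (s - 1) * Rpower x (s - 1)))))
  with (Rpower z (- s) * (Rpower z 1 * Rpower z (s - 1)) * (exp (- (z * x)) * Rpower x (s - 1))) by (rewrite Rpower_1 by auto; ring).
rewrite <- !Rpower_plus. replace (- s + (1 + (s - 1))) with 0 by ring.
rewrite Rpower_O by auto. ring.
Qed.

Lemma RGamma_1 : RGamma 1 = 1.
Proof.
destruct (RGamma_correct 1 ltac:(lra)) as [I _].
apply (is_RInt_gen_0_infty_unique _ _ _ I).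
replace 1 with (0 - (-1)) at 3 by ring.
apply (is_RInt_gen_derive_pos (fun t => - exp (- (1 * t)))).
- intros t Ht. unfold gint. unfold Rminus. rewrite Rplus_opp_r, Rpower_O by auto. auto_derive; auto. ring.
- intros; now apply gint_continuous.
- replace (-1) with (- exp (- (1 * 0))) by (rewrite Rmult_0_r, Ropp_0, exp_0; ring).
  apply (filterlim_at_right_continuous (fun t => - exp (- (1 * t)))).
  apply (ex_derive_continuous (K := R_AbsRing) (V := R_NormedModule)). auto_derive; auto.
- replace 0 with (- 0) by ring.
  apply (filterlim_comp _ _ _ (fun t => exp (- (1 * t))) Ropp _ (locally 0)).
  + apply exp_lim_infty; lra.
  + apply (continuous_opp (fun x : R => x) 0), continuous_id.
Qed.

(** Integration by parts: [exp (- t) * Rpower t s] tends to 0 at both ends, and its derivative is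
    [s * gint 1 s t - gint 1 (s + 1) t]. *)
Lemma RGamma_succ (s : R) : 0 < s -> RGamma (s + 1) = s * RGamma s.
Proof.
intros Hs.
assert (I1 := proj1 (RGamma_correct s Hs)).
assert (I2 := proj1 (RGamma_correct (s + 1) ltac:(lra))).
assert (I3 : is_RInt_gen (fun t => minus (scal s (gint 1 s t)) (gint 1 (s + 1) t)) (at_right 0) (Rbar_locally p_infty) (0 - 0)).
{ apply (is_RInt_gen_derive_pos (fun t => exp (- t) * Rpower t s)).
  - intros t Ht. unfold gint, minus, plus, opp, scal; simpl; unfold mult; simpl.
    replace (s + 1 - 1) with s by ring.
    unfold Rpower. auto_derive; auto.
    replace ((s - 1) * ln t) with (s * ln t + - ln t) by ring. rewrite exp_plus, (exp_Ropp (ln t)), exp_ln, Rmult_1_l by lra.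
    rewrite ?Rmult_1_l. field. lra.
  - intros t Ht. apply (continuous_minus (V := R_NormedModule)); [apply (continuous_scal_r (V := R_NormedModule))|]; now apply gint_continuous.
  - assert (Z : exp (- 0) * 0 = 0) by apply Rmult_0_r. rewrite <- Z at 2. clear Z.
    apply (filterlim_comp_2 (G := locally (exp (- 0))) (H := locally 0)).
    + apply (filterlim_at_right_continuous (fun t => exp (- t))).
      apply (ex_derive_continuous (K := R_AbsRing) (V := R_NormedModule)). auto_derive; auto.
    + apply Rpower_lim_0; auto.
    + apply (filterlim_mult (K := R_AbsRing)).
  - apply exp_Rpower_lim_infty; lra. }
assert (I4 := is_RInt_gen_minus _ _ _ _ (is_RInt_gen_scal _ s _ I1) I2).
assert (E := is_RInt_gen_0_infty_unique _ _ _ I3 I4). unfold minus, plus, opp, scal in E; simpl in E; unfold mult in E; simpl in E. lra.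
Qed.

(* The weighted AM-GM bound [t ^ th <= s ^ th * (1 - th + th * t / s)] is integrated
   against [exp (- t) * t ^ (s - 1)]. *)
Lemma RGamma_plus_le (s th : R) : 0 < s -> 0 <= th <= 1 ->
  RGamma (s + th) <= Rpower s th * RGamma s.
Proof.
intros Hs Hth.
assert (I1 := proj1 (RGamma_correct s Hs)).
assert (I2 := proj1 (RGamma_correct (s + 1) ltac:(lra))).
assert (I3 := proj1 (RGamma_correct (s + th) ltac:(lra))).
assert (I := is_RInt_gen_plus _ _ _ _ (is_RInt_gen_scal _ (Rpower s th * (1 - th)) _ I1) (is_RInt_gen_scal _ (Rpower s th * (th / s)) _ I2)).
assert (N := fun H H' => RInt_gen_norm _ _ _ _ H H' I3 I).
apply Rle_trans with (1 := Rle_abs _).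
eapply Rle_trans; [apply N|].
- apply (filter_prod_0_infty (fun a b => a <= b) 1 1); intros; lra.
- apply (filter_prod_0_infty (fun a b => forall x, a <= x <= b -> norm (gint 1 (s + th) x) <= _) 1 1); [lra|].
  intros a b Ha Hb t Ht. assert (Ht0 : 0 < t) by lra.
  unfold norm; simpl; unfold abs; simpl. rewrite Rabs_right by (left; apply gint_pos).
  unfold gint, plus, scal; simpl; unfold mult; simpl.
  replace (s + 1 - 1) with s by ring.
  set (u := ln t - ln s).
  assert (E1 : Rpower t (s + th - 1) = Rpower t (s - 1) * (Rpower s th * exp (th * u))).
  { unfold Rpower, u. rewrite <- !exp_plus. f_equal. ring. }
  assert (E2 : Rpower t s = Rpower t (s - 1) * (s * exp u)).
  { unfold Rpower, u. replace s with (exp (ln s)) at 3 by now apply exp_ln. rewrite <- !exp_plus. f_equal. ring. }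
  rewrite E1, E2.
  (* The tangent inequalities for [exp ((1 - th) * u)] and [exp (- (th * u))] are added with weights
     [th] and [1 - th], so that the terms linear in [u] cancel, and multiplied by [exp (th * u)]. *)
  assert (E3 : exp (th * u) <= 1 - th + th * exp u).
  { assert (A := exp_ineq1_le ((1 - th) * u)). assert (B := exp_ineq1_le (- (th * u))).
    assert (P := exp_pos (th * u)).
    replace (exp u) with (exp (th * u) * exp ((1 - th) * u)) by (rewrite <- exp_plus; f_equal; ring).
    assert (Q : exp (th * u) * exp (- (th * u)) = 1) by (rewrite <- exp_plus, Rplus_opp_r; apply exp_0).
    assert (A' := Rmult_le_compat_l _ _ _ (Rmult_le_pos th (exp (th * u)) ltac:(lra) ltac:(lra)) A).
    assert (B' := Rmult_le_compat_l _ _ _ (Rmult_le_pos (1 - th) (exp (th * u)) ltac:(lra) ltac:(lra)) B).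
    rewrite (Rmult_assoc _ _ (exp (- (th * u)))), Q in B'. lra. }
  assert (P : 0 < exp (- (1 * t)) * (Rpower t (s - 1) * Rpower s th)).
  { repeat apply Rmult_lt_0_compat; apply exp_pos. }
  apply Rle_trans with (exp (- (1 * t)) * (Rpower t (s - 1) * Rpower s th) * (1 - th + th * exp u)).
  + rewrite <- !Rmult_assoc. rewrite <- !Rmult_assoc in P. apply Rmult_le_compat_l; [lra|auto].
  + right. field. lra.
- unfold plus, scal; simpl; unfold mult; simpl. rewrite RGamma_succ by auto. right. field. lra.
Qed.

(** * Real-analytic functions and the identity theorem *)

Definition real_analytic (f : R -> R) (x : R) : Prop :=
  exists (a : nat -> R) (r : R), 0 < r /\
    forall h, Rabs h < r -> is_pseries a h (f (x + h)).

(** Convergence at one point strictly between [Rabs h] and [r] suffices, since outside the disk the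
    terms do not tend to 0. Only positive points are assumed, which makes one-sided information
    usable. *)
Lemma is_pseries_CV_radius (a : nat -> R) (f : R -> R) (r h : R) :
  (forall h, 0 < h < r -> is_pseries a h (f h)) -> Rabs h < r ->
  Rbar_lt (Rabs h) (CV_radius a).
Proof.
intros H Hh. apply Rbar_not_le_lt. intros N.
set (h' := (Rabs h + r) / 2).
assert (P := Rabs_pos h).
assert (Hh' : 0 < h' < r) by (unfold h'; lra).
apply (CV_disk_outside a h').
- apply Rbar_le_lt_trans with (1 := N). simpl. rewrite (Rabs_right h'); unfold h'; lra.
- apply ex_series_lim_0. eexists. apply is_pseries_R, H, Hh'.
Qed.

Lemma pseries_zero_right_0 (a : nat -> R) (d : R) : 0 < d ->
  (forall h, 0 < h < d -> is_pseries a h 0) -> a 0%nat = 0.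
Proof.
intros Hd H.
assert (R0 : Rbar_lt (Rabs 0) (CV_radius a)).
{ apply (is_pseries_CV_radius a (fun _ => 0) d); [auto|]. rewrite Rabs_R0; lra. }
destruct (Req_dec (a 0%nat) 0) as [|N]; auto. exfalso.
destruct (PSeries_continuity a 0 R0 (Rabs (a 0%nat)) (Rabs_pos_lt _ N)) as (e & He & C).
set (h := Rmin (e / 2) (d / 2)).
assert (0 < h) by (apply Rmin_pos; lra).
assert (h <= e / 2) by apply Rmin_l. assert (h <= d / 2) by apply Rmin_r.
specialize (C h). simpl in C. unfold R_dist in C.
rewrite PSeries_0, (is_pseries_unique _ _ _ (H h ltac:(lra))), Rminus_0_l, Rabs_Ropp in C.
apply (Rlt_irrefl (Rabs (a 0%nat))), C. split.
- split; [exact I|lra].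
- rewrite Rminus_0_r, Rabs_right; lra.
Qed.

(** The constant coefficient vanishes by continuity at 0. Division by [h > 0] then yields the
    shifted series, again with sum 0 on the right of 0. *)
Lemma pseries_zero_right (a : nat -> R) (d : R) : 0 < d ->
  (forall h, 0 < h < d -> is_pseries a h 0) -> forall k, a k = 0.
Proof.
intros Hd H k. revert a H. induction k as [|k IH]; intros a H.
- now apply pseries_zero_right_0 with d.
- apply (IH (PS_decr_1 a)). intros h Hh.
  assert (D := is_pseries_decr_1 (V := R_NormedModule) a h (/ h) 0).
  rewrite (pseries_zero_right_0 a d Hd H) in D.
  unfold scal, plus, opp, mult, one in D; simpl in D; unfold mult in D; simpl in D.
  rewrite Ropp_0, Rplus_0_r, Rmult_0_r in D. apply D; [|now apply H].
  apply Rinv_l; lra.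
Qed.

(** Zeros spread to the left. Let [T] be the largest distance from [p] reached. Just to the right of
    [p - T] the function vanishes, so all coefficients of its expansion at [p - T] are 0 and it
    vanishes on the left as well; [T < p - q] would contradict maximality. *)
Lemma real_analytic_zero (f : R -> R) (q p d : R) : q <= p -> 0 < d ->
  (forall x, q <= x <= p -> real_analytic f x) ->
  (forall x, p < x < p + d -> f x = 0) -> f q = 0.
Proof.
intros Hqp Hd Ha H0.
set (E := fun t => 0 <= t <= p - q /\ forall x, p - t < x < p + d -> f x = 0).
destruct (completeness E) as [T [Hub Hl]].
{ exists (p - q). intros t [Ht _]. lra. }
{ exists 0. split; [lra|]. intros x Hx. apply H0. lra. }
assert (HT : 0 <= T <= p - q).
{ split.
  - apply Hub. split; [lra|]. intros x Hx. apply H0. lra.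
  - apply Hl. intros t [Ht _]. lra. }
assert (Z : forall x, p - T < x < p + d -> f x = 0).
{ intros x Hx. destruct (classic (exists t, E t /\ p - t < x)) as [(t & [Ht Et] & Hxt)|N].
  - apply Et; lra.
  - exfalso. assert (T <= p - x); [|lra]. apply Hl. intros t Et.
    apply Rnot_lt_le. intros H. apply N. exists t; split; [auto|lra]. }
destruct (Ha (p - T) ltac:(lra)) as (a & r & Hr & Hp).
assert (A : forall k, a k = 0).
{ apply (pseries_zero_right a (Rmin r d)); [apply Rmin_pos; lra|].
  intros h Hh. assert (R1 := Rmin_l r d). assert (R2 := Rmin_r r d).
  rewrite <- (Z (p - T + h)) by lra. apply Hp. rewrite Rabs_right; lra. }
assert (Z' : forall h, Rabs h < r -> f (p - T + h) = 0).
{ intros h Hh. rewrite <- (is_pseries_unique _ _ _ (Hp h Hh)), (PSeries_ext _ (fun _ => 0)) by auto.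
  apply PSeries_const_0. }
destruct (Req_dec T (p - q)) as [ET|NT].
- rewrite <- (Z' 0) by (rewrite Rabs_R0; auto). f_equal. lra.
- exfalso. set (t := Rmin (T + r / 2) (p - q)).
  assert (T < t) by (apply Rmin_glb_lt; lra).
  assert (t <= T + r / 2) by apply Rmin_l. assert (t <= p - q) by apply Rmin_r.
  assert (t <= T); [|lra]. apply Hub. split; [lra|].
  intros x Hx. destruct (Rlt_le_dec (p - T) x) as [L|L]; [apply Z; lra|].
  replace x with (p - T + (x - (p - T))) by ring. apply Z'.
  rewrite Rabs_left1; lra.
Qed.

Lemma real_analytic_ext (f g : R -> R) (x : R) :
  (forall t, f t = g t) -> real_analytic f x -> real_analytic g x.
Proof. intros E (a & r & Hr & H). exists a, r. split; auto. intros h Hh. rewrite <- E. auto. Qed.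

Lemma real_analytic_plus (f g : R -> R) (x : R) :
  real_analytic f x -> real_analytic g x -> real_analytic (fun t => f t + g t) x.
Proof.
intros (a & r & Hr & H) (b & r' & Hr' & H'). exists (PS_plus a b), (Rmin r r').
split; [now apply Rmin_pos|]. intros h Hh.
apply (is_pseries_plus (V := R_NormedModule)).
- apply H. apply Rlt_le_trans with (1 := Hh), Rmin_l.
- apply H'. apply Rlt_le_trans with (1 := Hh), Rmin_r.
Qed.

Lemma real_analytic_mult (f g : R -> R) (x : R) :
  real_analytic f x -> real_analytic g x -> real_analytic (fun t => f t * g t) x.
Proof.
intros (a & r & Hr & H) (b & r' & Hr' & H'). exists (PS_mult a b), (Rmin r r').
split; [now apply Rmin_pos|]. intros h Hh.
assert (h1 : Rabs h < r) by (apply Rlt_le_trans with (1 := Hh), Rmin_l).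
assert (h2 : Rabs h < r') by (apply Rlt_le_trans with (1 := Hh), Rmin_r).
apply is_pseries_mult; auto.
- apply (is_pseries_CV_radius a (fun h => f (x + h)) r); auto.
  intros k Hk. apply H. rewrite Rabs_right; lra.
- apply (is_pseries_CV_radius b (fun h => g (x + h)) r'); auto.
  intros k Hk. apply H'. rewrite Rabs_right; lra.
Qed.

Lemma is_pseries_const {K : AbsRing} {V : NormedModule K} (c : V) (h : K) :
  is_pseries (fun n => match n with O => c | S _ => zero end) h c.
Proof.
unfold is_pseries, is_series.
apply (filterlim_ext (fun _ => c)); [|apply filterlim_const].
intros n. induction n as [|n IH].
- rewrite sum_O. simpl. symmetry. apply scal_one.
- rewrite sum_Sn, <- IH. cbv beta iota. rewrite (@scal_zero_r K V), (@plus_zero_r V). reflexivity.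
Qed.

Lemma real_analytic_const (c x : R) : real_analytic (fun _ => c) x.
Proof. exists (fun n => match n with O => c | S _ => 0 end), 1. split; [lra|]. intros h _. apply (is_pseries_const (V := R_NormedModule)). Qed.

Lemma real_analytic_id (x : R) : real_analytic (fun t => t) x.
Proof.
exists (PS_plus (fun n => match n with O => x | S _ => 0 end)
  (PS_incr_1 (fun n => match n with O => 1 | S _ => 0 end))), 1.
split; [lra|]. intros h _. apply (is_pseries_plus (V := R_NormedModule)).
- apply (is_pseries_const (V := R_NormedModule)).
- replace h with (scal h 1) at 2 by apply Rmult_1_r.
  apply (is_pseries_incr_1 (V := R_NormedModule)), (is_pseries_const (V := R_NormedModule)).
Qed.

Lemma real_analytic_exp (c x : R) : real_analytic (fun t => exp (c * t)) x.
Proof.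
exists (fun n => exp (c * x) * (c ^ n * / INR (fact n))), 1. split; [lra|].
intros h _. apply is_pseries_R.
rewrite Rmult_plus_distr_l, exp_plus.
assert (E := proj1 (is_pseries_R _ _ _) (is_exp_Reals (c * h))).
apply (is_series_scal_l (K := R_AbsRing) (exp (c * x))) in E.
eapply is_series_ext; [|exact E]. intros n. simpl.
rewrite Rpow_mult_distr. unfold scal; simpl; unfold mult; simpl. ring.
Qed.

(** * Restriction of complex analytic functions to the real axis *)

Lemma Re_sum_n (u : nat -> C) (n : nat) : Re (sum_n u n) = sum_n (fun i => Re (u i)) n.
Proof. induction n as [|n IH]; [now rewrite !sum_O|]. rewrite !sum_Sn, <- IH. reflexivity. Qed.

Lemma Im_sum_n (u : nat -> C) (n : nat) : Im (sum_n u n) = sum_n (fun i => Im (u i)) n.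
Proof. induction n as [|n IH]; [now rewrite !sum_O|]. rewrite !sum_Sn, <- IH. reflexivity. Qed.

Lemma is_series_Re (u : nat -> C) (l : C) :
  @is_series C_AbsRing C_NormedModule u l -> is_series (fun n => Re (u n)) (Re l).
Proof.
intros H P [e He].
destruct (H (fun z => P (Re z))) as [N HN].
{ exists e. intros z Hz. apply He. exact (proj1 Hz). }
exists N. intros n Hn. specialize (HN n Hn). rewrite Re_sum_n in HN. exact HN.
Qed.

Lemma is_series_Im (u : nat -> C) (l : C) :
  @is_series C_AbsRing C_NormedModule u l -> is_series (fun n => Im (u n)) (Im l).
Proof.
intros H P [e He].
destruct (H (fun z => P (Im z))) as [N HN].
{ exists e. intros z Hz. apply He. exact (proj2 Hz). }
exists N. intros n Hn. specialize (HN n Hn). rewrite Im_sum_n in HN. exact HN.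
Qed.

Lemma pow_n_RtoC (h : R) (k : nat) : @pow_n C_AbsRing (RtoC h) k = RtoC (h ^ k).
Proof.
induction k as [|k IH]; [reflexivity|]. simpl. rewrite IH, RtoC_mult. reflexivity.
Qed.

Lemma analytic_at_real (F : C -> C) (x : R) : analytic_at F (RtoC x) ->
  real_analytic (fun t => Re (F (RtoC t))) x /\ real_analytic (fun t => Im (F (RtoC t))) x.
Proof.
intros (a & r & Hr & H). split.
- exists (fun n => Re (a n)), r. split; auto. intros h Hh. apply is_pseries_R.
  specialize (H (RtoC h)). rewrite Cmod_R, <- RtoC_plus in H. specialize (H Hh).
  apply is_series_Re in H. eapply is_series_ext; [|exact H].
  intros n. simpl. rewrite pow_n_RtoC. unfold scal; simpl; unfold mult; simpl. unfold Re, Im. ring.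
- exists (fun n => Im (a n)), r. split; auto. intros h Hh. apply is_pseries_R.
  specialize (H (RtoC h)). rewrite Cmod_R, <- RtoC_plus in H. specialize (H Hh).
  apply is_series_Im in H. eapply is_series_ext; [|exact H].
  intros n. simpl. rewrite pow_n_RtoC. unfold scal; simpl; unfold mult; simpl. unfold Re, Im. ring.
Qed.

(** Both continuations go to the left along the real axis: the hypergeometric polynomial from the
    unit disk to the arguments [(1 - x) / 2 <= 0], and the Whittaker formula from positive to
    nonpositive values of [rho - nu + / 2]. Real and imaginary parts are handled separately. *)
Lemma analytic_continuation_left (F : C -> C) (g : R -> R) (q p d : R) :
  q <= p -> 0 < d ->
  (forall x, q <= x <= p -> analytic_at F (RtoC x)) ->
  (forall x, q <= x <= p -> real_analytic g x) ->
  (forall x, p < x < p + d -> F (RtoC x) = RtoC (g x)) ->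
  F (RtoC q) = RtoC (g q).
Proof.
intros Hqp Hd HF Hg E.
assert (E1 : Re (F (RtoC q)) + -1 * g q = 0).
{ apply (real_analytic_zero (fun t => Re (F (RtoC t)) + -1 * g t) q p d); auto.
  - intros x Hx. apply real_analytic_plus.
    + apply analytic_at_real; auto.
    + apply real_analytic_mult; [apply real_analytic_const|auto].
  - intros x Hx. rewrite E by auto. simpl. ring. }
assert (E2 : Im (F (RtoC q)) = 0).
{ apply (real_analytic_zero (fun t => Im (F (RtoC t))) q p d); auto.
  - intros x Hx. apply analytic_at_real; auto.
  - intros x Hx. rewrite E by auto. reflexivity. }
unfold Re, Im in *. apply injective_projections; simpl; lra.
Qed.

(** * Elementary forms of the hypergeometric and Whittaker functions *)

Lemma is_pseries_finite {K : AbsRing} {V : NormedModule K} (a : nat -> V) (h : K) (k : nat) :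
  (forall i, (k < i)%nat -> a i = zero) ->
  is_pseries a h (sum_n (fun i => scal (pow_n h i) (a i)) k).
Proof.
intros Ha. unfold is_pseries, is_series.
apply filterlim_ext_loc with (fun _ => sum_n (fun i => scal (pow_n h i) (a i)) k); [|apply filterlim_const].
exists k. intros n Hn. induction Hn as [|n Hn IH]; [reflexivity|].
rewrite sum_Sn, <- IH, Ha, (@scal_zero_r K V), (@plus_zero_r V) by lia. reflexivity.
Qed.

Lemma analytic_at_const (c z : C) : analytic_at (fun _ => c) z.
Proof.
exists (fun n => match n with O => c | S _ => RtoC 0 end), 1. split; [lra|].
intros h _. apply (is_pseries_const (V := C_NormedModule)).
Qed.

Lemma analytic_at_plus (F G : C -> C) (z : C) :
  analytic_at F z -> analytic_at G z -> analytic_at (fun w => F w + G w)%C z.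
Proof.
intros (a & r & Hr & H) (b & r' & Hr' & H'). exists (PS_plus a b), (Rmin r r').
split; [now apply Rmin_pos|]. intros h Hh.
apply (is_pseries_plus (V := C_NormedModule)).
- apply H. apply Rlt_le_trans with (1 := Hh), Rmin_l.
- apply H'. apply Rlt_le_trans with (1 := Hh), Rmin_r.
Qed.

Lemma analytic_at_id_mult (F : C -> C) (z : C) :
  analytic_at F z -> analytic_at (fun w => w * F w)%C z.
Proof.
intros (a & r & Hr & H).
exists (PS_plus (PS_scal (z : C_AbsRing) a) (PS_incr_1 a)), r. split; auto. intros h Hh.
rewrite Cmult_plus_distr_r.
apply (is_pseries_plus (V := C_NormedModule)).
- apply (is_pseries_scal (V := C_NormedModule)); auto. apply Cmult_comm.
- apply (is_pseries_incr_1 (V := C_NormedModule)); auto.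
Qed.

Lemma analytic_at_poly (a : nat -> C) (k : nat) (z : C) :
  analytic_at (fun w => sum_n (fun i => @scal C_AbsRing C_NormedModule (@pow_n C_AbsRing w i) (a i)) k) z.
Proof.
assert (M : forall i c, analytic_at (fun w => @scal C_AbsRing C_NormedModule (@pow_n C_AbsRing w i) c) z).
{ intros i c. induction i as [|i IH].
  - destruct (analytic_at_const c z) as (b & r & Hr & H). exists b, r. split; auto.
    intros h Hh. simpl. replace (scal one c) with c; [now apply H|]. symmetry; apply @scal_one.
  - destruct (analytic_at_id_mult _ _ IH) as (b & r & Hr & H). exists b, r. split; auto.
    intros h Hh. simpl. rewrite <- (@scal_assoc C_AbsRing C_NormedModule). now apply H. }
induction k as [|k IH].
- destruct (M 0%nat (a 0%nat)) as (b & r & Hr & H). exists b, r. split; auto.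
  intros h Hh. rewrite sum_O. now apply H.
- destruct (analytic_at_plus _ _ _ IH (M (S k) (a (S k)))) as (b & r & Hr & H). exists b, r. split; auto.
  intros h Hh. rewrite sum_Sn. now apply H.
Qed.

Fixpoint rpoch (a : R) (k : nat) : R :=
  match k with
  | O => 1
  | S k => rpoch a k * (a + INR k)
  end.

Lemma rpoch_pos (a : R) (k : nat) : 0 < a -> 0 < rpoch a k.
Proof.
intros Ha. induction k as [|k IH]; simpl; [lra|]. assert (H := pos_INR k). apply Rmult_lt_0_compat; lra.
Qed.

Lemma rpoch_neg_INR (k i : nat) : (k < i)%nat -> rpoch (- INR k) i = 0.
Proof.
intros H. induction H as [|i H IH]; simpl; [ring|]. rewrite IH. ring.
Qed.

Lemma Cpoch_RtoC (a : R) (k : nat) : Cpoch (RtoC a) k = RtoC (rpoch a k).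
Proof. induction k as [|k IH]; simpl; [reflexivity|]. now rewrite IH, <- RtoC_plus, <- RtoC_mult. Qed.

Lemma RGamma_plus_INR (s : R) (k : nat) : 0 < s -> RGamma (s + INR k) = rpoch s k * RGamma s.
Proof.
intros Hs. induction k as [|k IH]; [simpl; rewrite Rplus_0_r; ring|].
assert (H := pos_INR k).
rewrite S_INR, <- Rplus_assoc, RGamma_succ, IH by lra. simpl. ring.
Qed.

Lemma sum_n_RtoC (u : nat -> C) (v : nat -> R) (k : nat) :
  (forall i, u i = RtoC (v i)) -> sum_n u k = RtoC (sum_f_R0 v k).
Proof.
intros E. induction k as [|k IH].
- now rewrite sum_O.
- rewrite sum_Sn, IH, E. simpl. now rewrite RtoC_plus.
Qed.

Lemma real_analytic_rpoch (i : nat) (x : R) : real_analytic (fun t => rpoch t i) x.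
Proof.
induction i as [|i IH]; simpl.
- apply real_analytic_const.
- apply real_analytic_mult; [exact IH|].
  apply real_analytic_plus; [apply real_analytic_id|apply real_analytic_const].
Qed.

Lemma real_analytic_sum (f : nat -> R -> R) (k : nat) (x : R) :
  (forall i, real_analytic (f i) x) -> real_analytic (fun t => sum_f_R0 (fun i => f i t) k) x.
Proof.
intros H. induction k as [|k IH]; simpl; [apply H|]. apply real_analytic_plus; auto.
Qed.

Lemma real_analytic_pow (i : nat) (x : R) : real_analytic (fun t => t ^ i) x.
Proof.
induction i as [|i IH]; simpl.
- apply real_analytic_const.
- apply real_analytic_mult; [apply real_analytic_id|exact IH].
Qed.

Lemma hyp2F1_terminating (k : nat) (b c x : R) : 0 < c -> x <= 0 ->
  hyp2F1 (RtoC (- INR k)) (RtoC b) (RtoC c) (RtoC x) =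
  RtoC (sum_f_R0 (fun i => rpoch (- INR k) i * rpoch b i / (rpoch c i * INR (fact i)) * x ^ i) k).
Proof.
intros Hc Hx.
set (co := fun i => rpoch (- INR k) i * rpoch b i / (rpoch c i * INR (fact i))).
assert (E : forall i, hyp2F1_coeff (RtoC (- INR k)) (RtoC b) (RtoC c) i = RtoC (co i)).
{ intros i. unfold hyp2F1_coeff, co. rewrite !Cpoch_RtoC, <- !RtoC_mult, <- RtoC_div; [reflexivity|].
  apply Rgt_not_eq, Rmult_lt_0_compat; [now apply rpoch_pos|apply INR_fact_lt_0]. }
assert (Z : forall i, (k < i)%nat -> hyp2F1_coeff (RtoC (- INR k)) (RtoC b) (RtoC c) i = RtoC 0).
{ intros i Hi. rewrite E. unfold co. rewrite rpoch_neg_INR by auto. f_equal. unfold Rdiv; ring. }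
assert (V : forall t, sum_n (fun i => @scal C_AbsRing C_NormedModule (@pow_n C_AbsRing (RtoC t) i)
    (hyp2F1_coeff (RtoC (- INR k)) (RtoC b) (RtoC c) i)) k = RtoC (sum_f_R0 (fun i => co i * t ^ i) k)).
{ intros t. apply sum_n_RtoC. intros i. rewrite pow_n_RtoC, E, Rmult_comm, RtoC_mult. reflexivity. }
(* [hyp2F1] is a choice, so its specification is available only once some function satisfies it; the
   terminating series, a polynomial, does. *)
assert (S : is_hyp2F1 (RtoC (- INR k)) (RtoC b) (RtoC c) (hyp2F1 (RtoC (- INR k)) (RtoC b) (RtoC c))).
{ unfold hyp2F1. apply epsilon_spec.
  exists (fun z => sum_n (fun i => @scal C_AbsRing C_NormedModule (@pow_n C_AbsRing z i)
    (hyp2F1_coeff (RtoC (- INR k)) (RtoC b) (RtoC c) i)) k).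
  split.
  - intros z _. apply (is_pseries_finite (V := C_NormedModule)). exact Z.
  - intros z _. apply analytic_at_poly. }
destruct S as [S1 S2].
assert (S0 : forall t, Rabs t < 1 -> hyp2F1 (RtoC (- INR k)) (RtoC b) (RtoC c) (RtoC t) = RtoC (sum_f_R0 (fun i => co i * t ^ i) k)).
{ intros t Ht. rewrite <- V.
  apply (filterlim_locally_unique (K := C_AbsRing) (V := C_NormedModule) (F := eventually) (sum_n (fun i => @scal C_AbsRing C_NormedModule (@pow_n C_AbsRing (RtoC t) i)
    (hyp2F1_coeff (RtoC (- INR k)) (RtoC b) (RtoC c) i)))).
  - apply S1. now rewrite Cmod_R.
  - apply (is_pseries_finite (V := C_NormedModule)). exact Z. }
(* The specification gives the power series only inside the unit disk, while [x] may be below -1;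
   the segment from 0 to [x] avoids the cut. *)
apply (analytic_continuation_left _ (fun t => sum_f_R0 (fun i => co i * t ^ i) k) x 0 1); auto.
- lra.
- intros t Ht. apply S2. simpl. lra.
- intros t _. apply real_analytic_sum. intros i. apply real_analytic_mult; [apply real_analytic_const|apply real_analytic_pow].
- intros t Ht. apply S0. rewrite Rabs_right; lra.
Qed.

(** Along a line every monomial of total degree [N] becomes a multiple of [h ^ N], so the grouping
    by total degree is already a power series in [h]. Slopes of modulus at most 1 preserve the
    radius. *)
Lemma analytic3_at_line (W : C -> C -> C -> C) (p1 p2 p3 q1 q2 q3 t : C) :
  Cmod q1 <= 1 -> Cmod q2 <= 1 -> Cmod q3 <= 1 ->
  analytic3_at W (p1 + q1 * t)%C (p2 + q2 * t)%C (p3 + q3 * t)%C ->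
  analytic_at (fun w => W (p1 + q1 * w) (p2 + q2 * w) (p3 + q3 * w))%C t.
Proof.
intros H1 H2 H3 (a & r & Hr & H).
exists (fun N => sum_n (fun i => sum_n (fun j => monomial3 a q1 q2 q3 N i j) (N - i)) N), r.
split; auto. intros h Hh.
assert (L : forall q, Cmod q <= 1 -> Cmod (q * h)%C < r).
{ intros q Hq. rewrite Cmod_mult. apply Rle_lt_trans with (2 := Hh).
  rewrite <- (Rmult_1_l (Cmod h)) at 2. apply Rmult_le_compat_r; [apply Cmod_ge_0|auto]. }
destruct (H (q1 * h)%C (q2 * h)%C (q3 * h)%C (L _ H1) (L _ H2) (L _ H3)) as [_ S].
rewrite !Cmult_plus_distr_l, !Cplus_assoc.
unfold is_pseries. eapply is_series_ext; [|exact S].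
intros N. simpl.
assert (P : forall i, @pow_n C_AbsRing h i = (h ^ i)%C).
{ intros i. induction i as [|i IH]; [reflexivity|]. simpl. rewrite IH. reflexivity. }
rewrite P.
change (@scal C_AbsRing C_NormedModule (h ^ N)%C) with (@mult C_Ring (h ^ N)%C).
etransitivity; [|apply (sum_n_mult_l (K := C_Ring))]. apply sum_n_ext_loc. intros i Hi.
etransitivity; [|apply (sum_n_mult_l (K := C_Ring))]. apply sum_n_ext_loc. intros j Hj.
unfold monomial3. change (@mult C_Ring) with Cmult.
assert (E : (h ^ N = h ^ i * h ^ j * h ^ (N - i - j))%C).
{ rewrite <- !Cpow_add_r. f_equal. lia. }
rewrite E, !Cpow_mult_l. match goal with |- @eq _ ?x ?y => change (@eq C x y) end. ring.
Qed.

Lemma is_RInt_gen_sum_f_R0 (f : nat -> R -> R) (l : nat -> R) (k : nat) :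
  (forall i, is_RInt_gen (f i) (at_right 0) (Rbar_locally p_infty) (l i)) ->
  is_RInt_gen (fun t => sum_f_R0 (fun i => f i t) k) (at_right 0) (Rbar_locally p_infty) (sum_f_R0 l k).
Proof.
intros H. induction k as [|k IH]; simpl; [apply H|].
apply (is_RInt_gen_plus (V := R_NormedModule)); auto.
Qed.

(** Here [rho + nu - / 2 = k], so [(1 + u) ^ k] expands and its [i]-th term integrates to
    [Rpower z (- (t + i)) * RGamma (t + i)]. Division by [Gamma t] turns the Gamma values into
    [rpoch t i], which is polynomial in [t]: the right-hand side makes sense for all real [t]. *)
Lemma Whittaker_integral_binomial (k : nat) (t z : R) : 0 < t -> 0 < z ->
  Whittaker_integral (RtoC ((INR k + 1 - t) / 2)) (RtoC ((t + INR k) / 2)) (RtoC z) =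
  RtoC (Rpower z ((INR k + 1 - t) / 2) * exp (- (z / 2)) * sum_f_R0 (fun i => Binomial.C k i * rpoch t i / z ^ i) k).
Proof.
intros Ht Hz. unfold Whittaker_integral.
set (nu := RtoC ((INR k + 1 - t) / 2)). set (rho := RtoC ((t + INR k) / 2)).
assert (H2 : (/ 2)%C = RtoC (/ 2)) by (rewrite RtoC_inv; auto; lra).
assert (E1 : (rho + / 2)%C = RtoC ((t + INR k + 1) / 2)).
{ unfold rho. rewrite H2, <- RtoC_plus. f_equal. field. }
assert (E2 : (rho - nu + / 2)%C = RtoC t).
{ unfold rho, nu. rewrite H2, <- RtoC_minus, <- RtoC_plus. f_equal. field. }
assert (E3 : (rho - nu - / 2)%C = RtoC (t - 1)).
{ unfold rho, nu. rewrite H2, <- !RtoC_minus. f_equal. field. }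
assert (E4 : (rho + nu - / 2)%C = RtoC (INR k)).
{ unfold rho, nu. rewrite H2, <- RtoC_plus, <- RtoC_minus. f_equal. field. }
assert (E5 : (- RtoC z / 2)%C = RtoC (- (z / 2))).
{ rewrite <- RtoC_opp, <- RtoC_div by lra. f_equal. field. }
rewrite E1, E2, E3, E4, E5.
destruct (RGamma_correct t Ht) as (_ & EG & PG).
rewrite (CInt_0_infty_RtoC _ (fun u => sum_f_R0 (fun i => Binomial.C k i * gint z (t + INR i) u) k)
   (sum_f_R0 (fun i => Binomial.C k i * (Rpower z (- (t + INR i)) * RGamma (t + INR i))) k)).
- rewrite EG, Cpower_RtoC, Cexp_RtoC, <- RtoC_mult, <- RtoC_div, <- RtoC_mult by lra. f_equal.
  rewrite !scal_sum. apply sum_eq. intros i Hi.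
  rewrite RGamma_plus_INR by auto.
  replace (Rpower z ((INR k + 1 - t) / 2)) with (Rpower z ((t + INR k + 1) / 2) * Rpower z (- (t + INR i)) * Rpower z (INR i)).
  2:{ rewrite <- !Rpower_plus. f_equal. field. }
  rewrite Rpower_pow by auto. field. split; [apply pow_nonzero|]; lra.
- intros u Hu.
  rewrite <- RtoC_mult, <- RtoC_opp, Cexp_RtoC, Cpower_RtoC, Cpower_RtoC, Rpower_pow, <- !RtoC_mult by lra. f_equal.
  rewrite (Rplus_comm 1 u), binomial, scal_sum. apply sum_eq. intros i Hi.
  unfold gint. replace (t + INR i - 1) with (t - 1 + INR i) by ring.
  rewrite Rpower_plus, Rpower_pow, pow1 by auto. ring.
- apply (is_RInt_gen_sum_f_R0 (fun i u => Binomial.C k i * gint z (t + INR i) u)). intros i.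
  apply (is_RInt_gen_scal (V := R_NormedModule)), is_RInt_gen_gint; auto.
  assert (P := pos_INR i). lra.
Qed.

(* The line is [rho + nu - / 2 = k], parametrized by [t = rho - nu + / 2]. *)
Lemma Whittaker_elementary (W : C -> C -> C -> C) (k : nat) (t z : R) :
  is_Whittaker W -> 0 < z ->
  W (RtoC ((INR k + 1 - t) / 2)) (RtoC ((t + INR k) / 2)) (RtoC z) =
  RtoC (Rpower z ((INR k + 1 - t) / 2) * exp (- (z / 2)) * sum_f_R0 (fun i => Binomial.C k i * rpoch t i / z ^ i) k).
Proof.
intros [HW HA] Hz.
assert (H2 : (/ 2)%C = RtoC (/ 2)) by (rewrite RtoC_inv; auto; lra).
assert (HP : forall t, 0 < t -> W (RtoC ((INR k + 1 - t) / 2)) (RtoC ((t + INR k) / 2)) (RtoC z) =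
  RtoC (Rpower z ((INR k + 1 - t) / 2) * exp (- (z / 2)) * sum_f_R0 (fun i => Binomial.C k i * rpoch t i / z ^ i) k)).
{ intros u Hu. rewrite HW; [now apply Whittaker_integral_binomial|auto|].
  rewrite H2, <- RtoC_minus, <- RtoC_plus. simpl. lra. }
destruct (Rlt_le_dec 0 t) as [Ht|Ht]; auto.
set (F := fun w => W (RtoC ((INR k + 1) / 2) + RtoC (- / 2) * w)%C (RtoC (INR k / 2) + RtoC (/ 2) * w)%C (RtoC z + RtoC 0 * w)%C).
assert (EF : forall u : R, F (RtoC u) = W (RtoC ((INR k + 1 - u) / 2)) (RtoC ((u + INR k) / 2)) (RtoC z)).
{ intros u. unfold F. rewrite <- !RtoC_mult, <- !RtoC_plus.
  f_equal; f_equal; field. }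
rewrite <- EF.
(* The continuation starts from [1 < t < 2], where the integral converges. The power of [z] depends
   on [t] through its exponent and is treated as an exponential in [t]. *)
apply (analytic_continuation_left F (fun t => Rpower z ((INR k + 1 - t) / 2) * exp (- (z / 2)) * sum_f_R0 (fun i => Binomial.C k i * rpoch t i / z ^ i) k) t 1 1); [lra|lra| | |].
- intros u _. apply analytic3_at_line.
  + rewrite Cmod_R, Rabs_left; lra.
  + rewrite Cmod_R, Rabs_right; lra.
  + rewrite Cmod_R, Rabs_R0; lra.
  + apply HA. rewrite <- RtoC_mult, <- RtoC_plus. simpl. lra.
- intros u _.
  apply real_analytic_ext with (fun t => exp ((INR k + 1) / 2 * ln z) * exp (- (/ 2 * ln z) * t) * exp (- (z / 2)) * sum_f_R0 (fun i => Binomial.C k i * / z ^ i * rpoch t i) k).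
  + intros v. unfold Rpower. rewrite <- exp_plus. f_equal; [do 2 f_equal; field|].
    apply sum_eq. intros i _. unfold Rdiv. ring.
  + apply real_analytic_mult; [repeat apply real_analytic_mult|apply (real_analytic_sum (fun i t => Binomial.C k i * / z ^ i * rpoch t i)); intros i; apply real_analytic_mult];
      (apply real_analytic_const || apply real_analytic_exp || apply real_analytic_rpoch).
- intros u Hu. rewrite EF. apply HP. lra.
Qed.

(** * Asymptotics of the algebraic prefactor *)

Lemma exp_le (x y : R) : x <= y -> exp x <= exp y.
Proof. intros [H| ->]; [left; now apply exp_increasing|lra]. Qed.

(** The exponent is [Rmax 0 h] and not [Rabs h] because in the prefactor [h] may be arbitrarily
    negative, with [m / x ^ 3] large. *)
Lemma exp_minus_1_le (h : R) : Rabs (exp h - 1) <= Rabs h * exp (Rmax 0 h).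
Proof.
assert (H := exp_ineq1_le h).
destruct (Rle_lt_dec 0 h) as [P|P].
- rewrite Rmax_right, (Rabs_right h) by lra. rewrite Rabs_right by lra.
  assert (H' := exp_ineq1_le (- h)). assert (Q := exp_pos h).
  assert (E : exp h * exp (- h) = 1) by (rewrite <- exp_plus, Rplus_opp_r; apply exp_0).
  apply (Rmult_le_compat_l (exp h)) in H'; lra.
- rewrite Rmax_left, exp_0, (Rabs_left h) by lra.
  assert (exp h < 1) by (rewrite <- exp_0; apply exp_increasing; auto).
  rewrite Rabs_left; lra.
Qed.

Lemma MVT_0 (g g' : R -> R) (u : R) :
  (forall t, Rmin 0 u <= t <= Rmax 0 u -> is_derive g t (g' t)) ->
  exists c, Rmin 0 u <= c <= Rmax 0 u /\ Rabs c <= Rabs u /\ g u - g 0 = g' c * u.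
Proof.
intros H. destruct (MVT_gen g 0 u g') as (c & Hc & E).
- intros x Hx. apply H. lra.
- intros x Hx. apply continuity_pt_filterlim. apply (ex_derive_continuous (K := R_AbsRing) (V := R_NormedModule)). eexists; apply H; auto.
- exists c. repeat split; try tauto; [|rewrite E; ring].
  unfold Rmin, Rmax in Hc. destruct (Rle_dec 0 u).
  + rewrite !Rabs_right; lra.
  + rewrite !Rabs_left1; lra.
Qed.

Lemma exp_taylor_1 (h : R) : Rabs (exp h - 1 - h) <= h ^ 2 * exp (Rabs h).
Proof.
destruct (MVT_0 (fun t => exp t - 1 - t) (fun t => exp t - 1) h) as (c & _ & Hc & E).
{ intros t _. auto_derive; auto. ring. }
rewrite exp_0 in E. replace (exp h - 1 - h) with ((exp c - 1) * h) by lra.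
rewrite Rabs_mult, <- (pow2_abs h).
assert (H := exp_minus_1_le c).
assert (H' : exp (Rmax 0 c) <= exp (Rabs h)).
{ apply exp_le. apply Rmax_lub; [apply Rabs_pos|]. apply Rle_trans with (2 := Hc), Rle_abs. }
assert (P := Rabs_pos h). assert (P' := Rabs_pos c). assert (Q := exp_pos (Rmax 0 c)).
apply Rle_trans with (Rabs h * exp (Rabs h) * Rabs h); [|right; ring].
apply Rmult_le_compat_r; auto. apply Rle_trans with (1 := H). apply Rmult_le_compat; lra.
Qed.

Lemma ln_taylor_2 (u : R) : Rabs u <= / 2 -> Rabs (ln (1 + u) - u + u ^ 2 / 2) <= 2 * Rabs u ^ 3.
Proof.
intros Hu. assert (Hu' := proj1 (Rabs_le_between _ _) Hu).
destruct (MVT_0 (fun t => ln (1 + t) - t + t ^ 2 / 2) (fun t => t ^ 2 / (1 + t)) u) as (c & Hc1 & Hc & E).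
{ intros t Ht. assert (- / 2 <= t).
  { apply Rle_trans with (2 := proj1 Ht). apply Rmin_glb; lra. }
  auto_derive; [lra|]. field. lra. }
rewrite Rplus_0_r, ln_1 in E.
replace (ln (1 + u) - u + u ^ 2 / 2) with (c ^ 2 / (1 + c) * u) by lra.
assert (C0 : - / 2 <= c).
{ apply Rle_trans with (2 := proj1 Hc1). apply Rmin_glb; lra. }
rewrite Rabs_mult. unfold Rdiv. rewrite Rabs_mult, <- RPow_abs.
assert (I : 0 < / (1 + c) <= 2).
{ split; [apply Rinv_0_lt_compat; lra|]. replace 2 with (/ / 2) by field. apply Rinv_le_contravar; lra. }
rewrite (Rabs_right (/ (1 + c))) by lra.
assert (P := Rabs_pos c).
assert (S : Rabs c ^ 2 <= Rabs u ^ 2) by (apply pow_incr; lra).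
apply Rle_trans with (Rabs u ^ 2 * 2 * Rabs u); [|right; ring].
apply Rmult_le_compat_r; [apply Rabs_pos|]. apply Rmult_le_compat; try lra.
apply pow_le; auto.
Qed.

Lemma ln_1_plus_bounds (y : R) : 0 <= y -> y - y ^ 2 / 2 <= ln (1 + y) <= y.
Proof.
intros Hy.
destruct (MVT_0 (fun t => ln (1 + t) - t + t ^ 2 / 2) (fun t => t ^ 2 / (1 + t)) y) as (c & Hc1 & Hc & E).
{ intros t Ht. rewrite Rmin_left in Ht by lra. auto_derive; [lra|]. field. lra. }
rewrite Rmin_left in Hc1 by lra.
rewrite Rplus_0_r, ln_1 in E.
assert (0 <= c ^ 2 / (1 + c) * y).
{ apply Rmult_le_pos; [|lra]. apply Rmult_le_pos; [apply pow2_ge_0|left; apply Rinv_0_lt_compat; lra]. }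
split; [lra|].
rewrite <- (ln_exp y) at 2. apply ln_le; [lra|apply exp_ineq1_le].
Qed.

(** The difference of logarithms is 2 artanh y, an odd function, so the error after the linear term
    is cubic. The upper bound stays away from [y = 1], where the function diverges. *)
Lemma artanh_bounds (y : R) : 0 <= y < 1 ->
  0 <= ln (1 + y) - ln (1 - y) - 2 * y /\
  (y <= / 2 -> ln (1 + y) - ln (1 - y) - 2 * y <= 3 * y ^ 3).
Proof.
intros Hy.
destruct (MVT_0 (fun t => ln (1 + t) - ln (1 - t) - 2 * t) (fun t => 2 * t ^ 2 / (1 - t ^ 2)) y) as (c & Hc1 & Hc & E).
{ intros t Ht. rewrite Rmin_left, Rmax_right in Ht by lra. auto_derive; [lra|]. field. repeat split; nra. }
rewrite Rmin_left, Rmax_right in Hc1 by lra.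
rewrite Rplus_0_r, Rminus_0_r, ln_1 in E.
assert (0 < 1 - c ^ 2) by nra.
assert (0 <= 2 * c ^ 2 / (1 - c ^ 2)).
{ apply Rmult_le_pos; [nra|left; now apply Rinv_0_lt_compat]. }
split; [nra|].
intros Hy2.
assert (2 * c ^ 2 / (1 - c ^ 2) <= 3 * y ^ 2).
{ apply (Rmult_le_reg_r (1 - c ^ 2)); auto. unfold Rdiv. rewrite Rmult_assoc, Rinv_l by lra.
  assert (c ^ 2 <= y ^ 2) by (apply pow_incr; lra). assert (y ^ 2 <= / 4) by nra. nra. }
nra.
Qed.

(** With [y = / x] the two bases are [(1 - y) / (2 * y)] and [(1 + y) / (2 * y)], so for [x > 1] the
    logarithm of the product is [n * ln (2 * y) - n * ln (1 + y)] minus [j] times artanh y. Compared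
    with [n * ln (2 * y) - (n + j) * y], the first logarithm costs order [y ^ 2] and artanh costs
    order [j * y ^ 3]. *)
Lemma prefactor_asymp (n : R) : 0 < n ->
  exists K, 0 < K /\ forall (j : nat) (x : R), 1 <= x ->
  exists eps, Rabs eps <= K * ((/ x) ^ 2 * (1 + (n + INR j) / x)) /\
    Rpow0 ((x - 1) / 2) (INR j / 2) * Rpow0 ((x + 1) / 2) (- (n + INR j / 2)) =
    Rpower (2 / x) n * exp (- ((n + INR j) / x)) * (1 + eps).
Proof.
intros Hn. exists ((4 + 2 * n) * exp n). split; [apply Rmult_lt_0_compat; [lra|apply exp_pos]|].
intros j x Hx. set (y := / x).
assert (Hy : 0 < y <= 1).
{ split; [apply Rinv_0_lt_compat; lra|]. rewrite <- Rinv_1. apply Rinv_le_contravar; lra. }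
assert (Ex : x = / y) by (unfold y; rewrite Rinv_inv; auto).
assert (Hj := pos_INR j).
assert (E1 : 1 <= exp n) by (assert (T := exp_ineq1_le n); lra).
assert (B1 := ln_1_plus_bounds y ltac:(lra)).
set (D := y ^ 2 * (1 + (n + INR j) / x)).
assert (HD : D = y ^ 2 * (1 + (n + INR j) * y)) by reflexivity.
assert (HD1 : y ^ 2 <= D).
{ rewrite HD. assert (0 <= (n + INR j) * y) by (apply Rmult_le_pos; lra). assert (0 <= y ^ 2) by nra. nra. }
assert (P2 : Rpow0 ((x + 1) / 2) (- (n + INR j / 2)) = exp (- (n + INR j / 2) * (ln (1 + y) - ln (2 * y)))).
{ unfold Rpow0. destruct (Req_EM_T ((x + 1) / 2) 0); [lra|]. unfold Rpower. do 2 f_equal.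
  rewrite <- ln_div by lra. f_equal. rewrite Ex. field. lra. }
assert (P3 : Rpower (2 / x) n * exp (- ((n + INR j) / x)) = exp (n * ln (2 * y) - (n + INR j) * y)).
{ unfold Rpower. rewrite <- exp_plus. reflexivity. }
rewrite P2, P3.
(* For [y] beyond 1/2 the error unit [D] is at least 1/4, so an upper bound on [h] is enough; a
   lower bound would fail near [y = 1]. *)
assert (BIG : forall h, h <= n -> / 2 < y -> Rabs (exp h - 1) <= (4 + 2 * n) * exp n * D).
{ intros h Hh Hy2. assert (exp h <= exp n) by now apply exp_le. assert (0 < exp h) by apply exp_pos.
  assert (Rabs (exp h - 1) <= exp n) by (apply Rabs_le; lra).
  assert (/ 4 <= y ^ 2) by nra.
  assert (1 <= (4 + 2 * n) * D).
  { replace 1 with (4 * / 4) by field. apply Rmult_le_compat; lra. }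
  rewrite (Rmult_comm _ (exp n)), Rmult_assoc.
  apply Rle_trans with (exp n * 1); [lra|]. apply Rmult_le_compat_l; lra. }
assert (MAIN : forall h, h <= n * (y - ln (1 + y)) -> (y <= / 2 -> n * (y - ln (1 + y)) - 3 / 2 * INR j * y ^ 3 <= h) ->
   Rabs (exp h - 1) <= (4 + 2 * n) * exp n * D).
{ intros h h1 h2. assert (hn : h <= n).
  { apply Rle_trans with (1 := h1). rewrite <- (Rmult_1_r n) at 2. apply Rmult_le_compat_l; nra. }
  destruct (Rle_lt_dec y (/ 2)) as [L|L]; [|now apply BIG].
  specialize (h2 L).
  apply Rle_trans with (1 := exp_minus_1_le h).
  assert (exp (Rmax 0 h) <= exp n) by (apply exp_le, Rmax_lub; lra).
  assert (Q := exp_pos (Rmax 0 h)).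
  assert (Rabs h <= (4 + 2 * n) * D).
  { assert (0 <= y ^ 3) by (apply pow_le; lra).
    assert (0 <= INR j * y ^ 3) by (apply Rmult_le_pos; lra).
    assert (0 <= n * y ^ 2) by (apply Rmult_le_pos; nra).
    assert (0 <= n * y ^ 3) by (apply Rmult_le_pos; nra).
    assert (HD' : D = y ^ 2 + n * y ^ 3 + INR j * y ^ 3) by (rewrite HD; ring).
    assert (0 <= n * D) by (apply Rmult_le_pos; lra).
    assert (n * y ^ 2 <= n * D) by (apply Rmult_le_compat_l; lra).
    assert (0 <= y ^ 2) by nra.
    apply Rabs_le. split; nra. }
  assert (0 <= Rabs h) by apply Rabs_pos.
  rewrite Rmult_assoc, (Rmult_comm (exp n)), <- Rmult_assoc. apply Rmult_le_compat; lra. }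
destruct (Rle_lt_or_eq_dec 1 x Hx) as [Hx1|Hx1].
- assert (Hy1 : y < 1).
  { rewrite <- Rinv_1. unfold y. apply Rinv_lt_contravar; lra. }
  destruct (artanh_bounds y ltac:(lra)) as [A1 A2].
  set (h := n * (y - ln (1 + y)) - INR j / 2 * (ln (1 + y) - ln (1 - y) - 2 * y)).
  exists (exp h - 1). split.
  + apply MAIN.
    * unfold h. assert (0 <= INR j / 2 * (ln (1 + y) - ln (1 - y) - 2 * y)) by (apply Rmult_le_pos; lra). lra.
    * intros L. specialize (A2 L). unfold h. nra.
  + unfold Rpow0. destruct (Req_EM_T ((x - 1) / 2) 0); [lra|].
    replace ((x - 1) / 2) with ((1 - y) / (2 * y)) by (rewrite Ex; field; lra).
    unfold Rpower. rewrite ln_div by lra. replace (1 + (exp h - 1)) with (exp h) by ring.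
    rewrite <- !exp_plus. f_equal. unfold h. field.
(* At [x = 1] the first base is 0. For [j = 0] the convention 0^0 = 1 leaves the formula above
   without its artanh term; for [j > 0] the product is 0 and [eps = -1], which is admissible since
   [D >= 1]. *)
- assert (Y1 : y = 1) by (unfold y; rewrite <- Hx1; apply Rinv_1).
  unfold Rpow0. destruct (Req_EM_T ((x - 1) / 2) 0); [|lra].
  destruct j as [|j].
  + destruct (Req_EM_T (INR 0 / 2) 0) as [_|N]; [|exfalso; apply N; simpl; field].
    exists (exp (n * (y - ln (1 + y))) - 1). split.
    * apply MAIN; simpl INR; lra.
    * replace (1 + (exp (n * (y - ln (1 + y))) - 1)) with (exp (n * (y - ln (1 + y)))) by ring.
      rewrite Rmult_1_l, <- exp_plus. f_equal. simpl INR. field.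
  + rewrite S_INR in *. destruct (Req_EM_T ((INR j + 1) / 2) 0); [assert (T := pos_INR j); lra|].
    exists (-1). split; [|ring]. rewrite Rabs_left by lra.
    fold D. replace (- (-1)) with (1 * 1 * 1) by ring. rewrite Y1 in HD1.
    apply Rmult_le_compat; [lra|lra| |lra]. apply Rmult_le_compat; lra.
Qed.

(** * Asymptotics of Gamma quotients *)

Lemma RGamma_INR (k : nat) : RGamma (INR k + 1) = INR (fact k).
Proof.
induction k as [|k IH].
- simpl. rewrite Rplus_0_l. apply RGamma_1.
- rewrite S_INR, RGamma_succ, IH, fact_simpl, mult_INR, S_INR by (assert (H := pos_INR k); lra). ring.
Qed.

Lemma ln_shift (a : R) : exists K, 0 <= K /\ forall m, 2 * Rabs a + 1 <= m ->
  Rabs (ln (m + a) - ln m - a / m + a ^ 2 / (2 * m ^ 2)) <= K / m ^ 3.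
Proof.
exists (2 * Rabs a ^ 3). assert (P := Rabs_pos a).
split; [apply Rmult_le_pos; [lra|now apply pow_le]|].
intros m Hm. assert (Hm0 : 0 < m) by lra.
assert (Hu : Rabs (a / m) <= / 2).
{ unfold Rdiv. rewrite Rabs_mult, (Rabs_right (/ m)) by (left; now apply Rinv_0_lt_compat).
  apply (Rmult_le_reg_r m); auto. rewrite Rmult_assoc, Rinv_l by lra. lra. }
assert (T := ln_taylor_2 (a / m) Hu).
assert (Hu' := proj1 (Rabs_le_between _ _) Hu).
replace (m + a) with (m * (1 + a / m)) by (field; lra).
rewrite ln_mult by lra.
replace (ln m + ln (1 + a / m) - ln m - a / m + a ^ 2 / (2 * m ^ 2)) with (ln (1 + a / m) - a / m + (a / m) ^ 2 / 2) by (field; lra).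
apply Rle_trans with (1 := T). right.
unfold Rdiv. rewrite Rabs_mult, (Rabs_right (/ m)) by (left; now apply Rinv_0_lt_compat).
rewrite Rpow_mult_distr, pow_inv. ring.
Qed.

Lemma is_lim_seq_ln_shift (a b : R) : 0 < a -> 0 < b ->
  is_lim_seq (fun j => ln (a + INR j) - ln (b + INR j)) 0.
Proof.
intros Ha Hb.
apply is_lim_seq_ext with (fun j => ln (1 + (a - b) * / (b + INR j))).
{ intros j. assert (H := pos_INR j). rewrite <- ln_div by lra. f_equal. field. lra. }
rewrite <- ln_1. apply is_lim_seq_continuous.
{ apply continuity_pt_filterlim, (ex_derive_continuous (K := R_AbsRing) (V := R_NormedModule)). auto_derive. lra. }
replace (Finite 1) with (Finite (1 + (a - b) * 0)) by (f_equal; ring).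
apply (is_lim_seq_plus' _ _ 1); [apply is_lim_seq_const|].
apply (is_lim_seq_scal_l _ (a - b) 0).
replace (Finite 0) with (Rbar_inv p_infty) by reflexivity.
apply is_lim_seq_inv; [|discriminate].
apply (is_lim_seq_plus _ _ b p_infty); [apply is_lim_seq_const|apply is_lim_seq_INR|].
reflexivity.
Qed.

(** [RGamma_plus_le] is used twice, for the step from [s] to [s + th] and for the step from [s + th]
    to [s + 1]; as [RGamma (s + 1) = s * RGamma s], the second gives the lower bound. *)
Lemma lnGamma_asymp_frac (th : R) : 0 <= th <= 1 ->
  is_lim_seq (fun j => ln (RGamma (1 + th + INR j)) - ln (INR (fact j)) - th * ln (1 + INR j)) 0.
Proof.
intros Hth.
apply is_lim_seq_le_le with (fun j => - ((1 - th) * (ln (1 + th + INR j) - ln (1 + INR j)))) (fun _ => 0).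
- intros j. assert (H := pos_INR j). set (s := 1 + INR j).
  replace (1 + th + INR j) with (s + th) by (unfold s; ring).
  assert (Hs : 0 < s) by (unfold s; lra).
  rewrite <- RGamma_INR, (Rplus_comm (INR j) 1). fold s.
  assert (A := RGamma_plus_le s th Hs Hth).
  assert (B := RGamma_plus_le (s + th) (1 - th) ltac:(lra) ltac:(lra)).
  replace (s + th + (1 - th)) with (s + 1) in B by ring. rewrite RGamma_succ in B by auto.
  assert (P := RGamma_pos s Hs). assert (P' := RGamma_pos (s + th) ltac:(lra)).
  apply ln_le in A; [|auto]. rewrite ln_mult, ln_Rpower in A; [|apply exp_pos|auto].
  apply ln_le in B; [|apply Rmult_lt_0_compat; auto]. rewrite ln_mult, (ln_mult (Rpower _ _)), ln_Rpower in B; auto; [|apply exp_pos].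
  lra.
- replace (Finite 0) with (Finite (- ((1 - th) * 0))) by (f_equal; ring).
  change (Finite (- ((1 - th) * 0))) with (Rbar_opp (Finite ((1 - th) * 0))).
  apply -> is_lim_seq_opp. apply (is_lim_seq_scal_l _ (1 - th) 0), is_lim_seq_ln_shift; lra.
- apply is_lim_seq_const.
Qed.

(** Leading order only, Gamma (a + j) ~ j! j^(a - 1). It supplies the limit, which increments alone
    cannot determine; the rate comes from the increments. *)
Lemma lnGamma_asymp (a : R) : 1 <= a ->
  is_lim_seq (fun j => ln (RGamma (a + INR j)) - ln (INR (fact j)) - (a - 1) * ln (1 + INR j)) 0.
Proof.
intros Ha.
assert (G : forall (N : nat) th, 0 <= th <= 1 ->
  is_lim_seq (fun j => ln (RGamma (1 + th + INR N + INR j)) - ln (INR (fact j)) - (th + INR N) * ln (1 + INR j)) 0).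
{ intros N th Hth. induction N as [|N IH].
  - apply is_lim_seq_ext with (2 := lnGamma_asymp_frac th Hth). intros j. simpl (INR 0). now rewrite !Rplus_0_r.
  - replace (Finite 0) with (Finite (0 + 0)) by (f_equal; ring).
    assert (HN := pos_INR N).
    apply is_lim_seq_ext with (2 := is_lim_seq_plus' _ _ _ _ IH (is_lim_seq_ln_shift (1 + th + INR N) 1 ltac:(lra) ltac:(lra))).
    intros j. assert (Hj := pos_INR j). rewrite S_INR.
    replace (1 + th + (INR N + 1) + INR j) with (1 + th + INR N + INR j + 1) by ring.
    rewrite RGamma_succ, ln_mult by (try apply RGamma_pos; lra). ring. }
destruct (nfloor_ex (a - 1) ltac:(lra)) as [N HN].
apply is_lim_seq_ext with (2 := G N (a - 1 - INR N) ltac:(lra)).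
intros j. f_equal; [do 3 f_equal; ring|]. ring.
Qed.

Lemma finite_max (f : nat -> R) (J : nat) : exists M, 0 <= M /\ forall j, (j < J)%nat -> f j <= M.
Proof.
induction J as [|J (M & HM & H)].
- exists 0. split; [lra|]. intros; lia.
- exists (Rmax M (f J)). split; [apply Rle_trans with (1 := HM), Rmax_l|].
  intros j Hj. destruct (Nat.eq_dec j J) as [->|N]; [apply Rmax_r|].
  apply Rle_trans with (2 := Rmax_l _ _). apply H. lia.
Qed.

(** As [d] tends to 0, [d j] is minus the sum of all later increments, and the tails of a series of
    order m^-3 are of order m^-2. *)
Lemma decay_from_increments (d : nat -> R) (n K : R) (J : nat) : 0 < n -> 0 <= K ->
  is_lim_seq d 0 ->
  (forall j, (J <= j)%nat -> Rabs (d (S j) - d j) <= K / (n + INR j) ^ 3) ->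
  exists M, 0 <= M /\ forall j, Rabs (d j) <= M / (n + INR j) ^ 2.
Proof.
intros Hn HK Hd Hinc.
destruct (nfloor_ex 1 ltac:(lra)) as [J1 HJ1].
set (J0 := Nat.max J (S J1)).
assert (HJ0 : forall j, (J0 <= j)%nat -> 1 <= n + INR j).
{ intros j Hj. assert (INR (S J1) <= INR j) by (apply le_INR; lia). rewrite S_INR in *. lra. }
(* A telescoping majorant: with [m = n + j], the inequality [K / m ^ 3 <= q j - q (S j)] amounts to
   [1 <= 3 * m ^ 2] when [K > 0], which [J0] ensures through [m >= 1]. *)
set (q := fun j => 2 * K / (n + INR j) ^ 2).
assert (Hstep : forall j, (J0 <= j)%nat -> Rabs (d (S j) - d j) <= q j - q (S j)).
{ intros j Hj. apply Rle_trans with (1 := Hinc j ltac:(lia)). unfold q. rewrite S_INR, <- Rplus_assoc.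
  specialize (HJ0 j Hj). set (m := n + INR j) in *.
  assert (0 < m ^ 3) by (apply pow_lt; lra). assert (0 < (m + 1) ^ 2) by (apply pow_lt; lra).
  replace (2 * K / m ^ 2 - 2 * K / (m + 1) ^ 2) with (K / m ^ 3 * (2 * m * (2 * m + 1) / (m + 1) ^ 2)) by (field; lra).
  rewrite <- (Rmult_1_r (K / m ^ 3)) at 1. apply Rmult_le_compat_l.
  - apply Rmult_le_pos; [auto|left; now apply Rinv_0_lt_compat].
  - apply (Rmult_le_reg_r ((m + 1) ^ 2)); auto. unfold Rdiv. rewrite (Rmult_assoc _ (/ _)), Rinv_l by lra. nra. }
assert (Hsum : forall j p, (J0 <= j)%nat -> Rabs (d (j + p)%nat - d j) <= q j - q (j + p)%nat).
{ intros j p Hj. induction p as [|p IH].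
  - rewrite Nat.add_0_r, !Rminus_diag, Rabs_R0. lra.
  - rewrite Nat.add_succ_r. specialize (Hstep (j + p)%nat ltac:(lia)).
    replace (d (S (j + p)) - d j) with ((d (S (j + p)) - d (j + p)%nat) + (d (j + p)%nat - d j)) by ring.
    apply Rle_trans with (1 := Rabs_triang _ _). lra. }
assert (Hq : forall j, 0 <= q j).
{ intros j. unfold q. assert (Hj := pos_INR j). apply Rmult_le_pos; [lra|]. left. apply Rinv_0_lt_compat, pow_lt. lra. }
assert (Hbig : forall j, (J0 <= j)%nat -> Rabs (d j) <= q j).
{ intros j Hj.
  assert (L : is_lim_seq (fun p => Rabs (d (p + j)%nat - d j)) (Rabs (0 - d j))).
  { apply is_lim_seq_continuous with (f := Rabs) (u := fun p => d (p + j)%nat - d j).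
    - apply Rcontinuity_abs.
    - apply is_lim_seq_minus'; [now apply is_lim_seq_incr_n|apply is_lim_seq_const]. }
  rewrite Rminus_0_l, Rabs_Ropp in L.
  apply (is_lim_seq_le (fun p => Rabs (d (p + j)%nat - d j)) (fun _ => q j) (Rabs (d j)) (q j)); [|exact L|apply is_lim_seq_const].
  intros p. rewrite Nat.add_comm. specialize (Hsum j p Hj). specialize (Hq (j + p)%nat). lra. }
(* The finitely many indices below [J0] only enlarge the constant. *)
destruct (finite_max (fun j => Rabs (d j) * (n + INR j) ^ 2) J0) as (M & HM & H).
exists (Rmax M (2 * K)). split; [apply Rle_trans with (1 := HM), Rmax_l|].
intros j. assert (Hj := pos_INR j). assert (P : 0 < (n + INR j) ^ 2) by (apply pow_lt; lra).
apply (Rmult_le_reg_r ((n + INR j) ^ 2)); auto. unfold Rdiv. rewrite Rmult_assoc, Rinv_l, Rmult_1_r by lra.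
destruct (Nat.le_gt_cases J0 j) as [L|L].
- apply Rle_trans with (2 := Rmax_r _ _). specialize (Hbig j L). unfold q in Hbig.
  apply (Rmult_le_compat_r ((n + INR j) ^ 2)) in Hbig; [|lra].
  unfold Rdiv in Hbig. rewrite Rmult_assoc, Rinv_l in Hbig by lra. lra.
- apply Rle_trans with (2 := Rmax_l _ _). apply H; auto.
Qed.

Lemma exp_second_order (n r M L d m : R) : 0 < n <= m -> 0 <= M ->
  L = r / m + d -> Rabs d <= M / m ^ 2 ->
  Rabs (exp L - 1 - r / m) <= (M + (Rabs r + M / n) ^ 2 * exp ((Rabs r + M / n) / n)) / m ^ 2.
Proof.
intros Hm HM HL Hd.
set (B := Rabs r + M / n).
assert (HB : 0 <= B).
{ apply Rplus_le_le_0_compat; [apply Rabs_pos|]. apply Rmult_le_pos; auto. left; apply Rinv_0_lt_compat; lra. }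
assert (Im : 0 < / m) by (apply Rinv_0_lt_compat; lra).
assert (In : / m <= / n) by (apply Rinv_le_contravar; lra).
assert (H1 : Rabs L <= B * / m).
{ rewrite HL. apply Rle_trans with (1 := Rabs_triang _ _). unfold B.
  unfold Rdiv at 1. rewrite Rabs_mult, (Rabs_right (/ m)), Rmult_plus_distr_r by lra.
  apply Rplus_le_compat_l. apply Rle_trans with (1 := Hd).
  unfold Rdiv. rewrite Rmult_assoc. apply Rmult_le_compat_l; auto.
  replace (/ m ^ 2) with (/ m * / m) by (field; lra). apply Rmult_le_compat_r; lra. }
assert (H2 : Rabs L <= B / n).
{ apply Rle_trans with (1 := H1). apply Rmult_le_compat_l; lra. }
replace (exp L - 1 - r / m) with ((exp L - 1 - L) + d) by lra.
apply Rle_trans with (1 := Rabs_triang _ _).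
assert (T := exp_taylor_1 L).
assert (E := exp_le _ _ H2).
assert (S : L ^ 2 <= B ^ 2 * / m ^ 2).
{ rewrite <- pow2_abs, <- pow_inv, <- Rpow_mult_distr. apply pow_incr. split; [apply Rabs_pos|auto]. }
assert (L ^ 2 * exp (Rabs L) <= B ^ 2 * / m ^ 2 * exp (B / n)).
{ apply Rmult_le_compat; auto; [apply pow2_ge_0|left; apply exp_pos]. }
unfold Rdiv at 1. rewrite Rmult_plus_distr_r. unfold Rdiv in Hd. unfold Rdiv in H. fold B. unfold Rdiv. lra.
Qed.

(** [L j] is the logarithm of the quotient divided by [Rpower m (n - i - / 2)], where [m = n + j].
    By the functional equation its increment is a combination of logarithms of [m] shifted by
    constants. The coefficient of [1 / m] is 0 and that of [1 / m ^ 2] is [- r] with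
    [2 * r = (al / 2) ^ 2 - s ^ 2], [s = / 2 - n + i]; factoring this difference of squares gives
    the stated [r]. *)
Lemma Gamma_ratio_asymp (al : R) (k i : nat) : 0 <= al ->
  let n := (al + 1) / 2 + INR k in
  let r := - ((INR k - INR i) * (al + INR k - INR i)) / 2 in
  exists K, 0 <= K /\ forall j, exists dl, Rabs dl <= K / (n + INR j) ^ 2 /\
    sqrt (INR (fact (k + j)) * RGamma (al + 1 + INR k + INR j)) / INR (fact (i + j)) =
    Rpower (n + INR j) (n - INR i - / 2) * (1 + r / (n + INR j) + dl).
Proof.
intros Hal n r. assert (Hk := pos_INR k). assert (Hi := pos_INR i).
assert (Hn : 0 < n) by (unfold n; lra).
set (lam := fun a j => ln (RGamma (a + INR j))).
set (L := fun j => / 2 * lam (INR k + 1) j + / 2 * lam (al + 1 + INR k) j - lam (INR i + 1) j + (/ 2 - n + INR i) * ln (n + INR j)).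
assert (Hlam : forall a j, 0 < a -> lam a (S j) - lam a j = ln (a + INR j)).
{ intros a j Ha. assert (Hj := pos_INR j). unfold lam. rewrite S_INR, <- Rplus_assoc, RGamma_succ, ln_mult by (try apply RGamma_pos; lra). ring. }
assert (Llim : is_lim_seq L 0).
{ assert (A1 := lnGamma_asymp (INR k + 1) ltac:(lra)).
  assert (A2 := lnGamma_asymp (al + 1 + INR k) ltac:(lra)).
  assert (A3 := lnGamma_asymp (INR i + 1) ltac:(lra)).
  assert (A4 := is_lim_seq_ln_shift n 1 Hn ltac:(lra)).
  apply (is_lim_seq_scal_l _ (/ 2)) in A1. apply (is_lim_seq_scal_l _ (/ 2)) in A2.
  apply (is_lim_seq_scal_l _ (/ 2 - n + INR i)) in A4.
  simpl in A1, A2, A4. rewrite Rmult_0_r in A1, A2, A4.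
  assert (A := is_lim_seq_plus' _ _ _ _ (is_lim_seq_minus' _ _ _ _ (is_lim_seq_plus' _ _ _ _ A1 A2) A3) A4).
  replace (0 + 0 - 0 + 0) with 0 in A by ring.
  apply is_lim_seq_ext with (2 := A). intros j. unfold L, lam, n. field. }
assert (Dlim : is_lim_seq (fun j => L j - r * / (n + INR j)) 0).
{ replace (Finite 0) with (Finite (0 - r * 0)) by (f_equal; ring).
  apply is_lim_seq_minus'; auto. apply (is_lim_seq_scal_l _ r 0).
  replace (Finite 0) with (Rbar_inv p_infty) by reflexivity.
  apply is_lim_seq_inv; [|discriminate].
  apply (is_lim_seq_plus _ _ n p_infty); [apply is_lim_seq_const|apply is_lim_seq_INR|reflexivity]. }
destruct (ln_shift (/ 2 - al / 2)) as (K1 & HK1 & S1).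
destruct (ln_shift (/ 2 + al / 2)) as (K2 & HK2 & S2).
destruct (ln_shift (INR i + 1 - n)) as (K3 & HK3 & S3).
destruct (ln_shift 1) as (K4 & HK4 & S4).
set (s := / 2 - n + INR i).
set (K := / 2 * K1 + / 2 * K2 + K3 + Rabs s * K4 + Rabs r).
assert (HK : 0 <= K).
{ unfold K. assert (0 <= Rabs s * K4) by (apply Rmult_le_pos; [apply Rabs_pos|auto]). assert (Hr := Rabs_pos r). lra. }
(* From this threshold on, [ln_shift] applies to all four shifts at once. *)
set (B := 2 * (Rabs (/ 2 - al / 2) + Rabs (/ 2 + al / 2) + Rabs (INR i + 1 - n) + 1) + 1).
assert (P1 := Rabs_pos (/ 2 - al / 2)). assert (P2 := Rabs_pos (/ 2 + al / 2)). assert (P3 := Rabs_pos (INR i + 1 - n)).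
destruct (nfloor_ex B ltac:(unfold B; lra)) as [J HJ].
destruct (decay_from_increments (fun j => L j - r * / (n + INR j)) n K (S J) Hn HK Dlim) as (M & HM & HD).
{ intros j Hj. apply le_INR in Hj. rewrite S_INR in Hj.
  assert (E : L (S j) - r * / (n + INR (S j)) - (L j - r * / (n + INR j)) =
     / 2 * (lam (INR k + 1) (S j) - lam (INR k + 1) j) + / 2 * (lam (al + 1 + INR k) (S j) - lam (al + 1 + INR k) j)
     - (lam (INR i + 1) (S j) - lam (INR i + 1) j) + s * (ln (n + INR (S j)) - ln (n + INR j)) - r * (/ (n + INR (S j)) - / (n + INR j))).
  { unfold L, s. ring. }
  rewrite E, !Hlam, S_INR, <- Rplus_assoc by lra. clear E.
  set (m := n + INR j).
  replace (INR k + 1 + INR j) with (m + (/ 2 - al / 2)) by (unfold m, n; field).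
  replace (al + 1 + INR k + INR j) with (m + (/ 2 + al / 2)) by (unfold m, n; field).
  replace (INR i + 1 + INR j) with (m + (INR i + 1 - n)) by (unfold m; ring).
  assert (Hm : B <= m) by (unfold m; lra). unfold B in Hm.
  rewrite (Rabs_right 1) in S4 by lra.
  specialize (S1 m ltac:(lra)). specialize (S2 m ltac:(lra)). specialize (S3 m ltac:(lra)). specialize (S4 m ltac:(lra)).
  set (T1 := ln (m + (/ 2 - al / 2)) - _ - _ + _) in S1.
  set (T2 := ln (m + (/ 2 + al / 2)) - _ - _ + _) in S2.
  set (T3 := ln (m + (INR i + 1 - n)) - _ - _ + _) in S3.
  set (T4 := ln (m + 1) - _ - _ + _) in S4.
  assert (Hm0 : 0 < m) by lra.
  (* The coefficients of [1 / m] and [1 / m ^ 2] cancel. *)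
  replace (/ 2 * ln (m + (/ 2 - al / 2)) + / 2 * ln (m + (/ 2 + al / 2)) - ln (m + (INR i + 1 - n)) + s * (ln (m + 1) - ln m) - r * (/ (m + 1) - / m))
    with (/ 2 * T1 + / 2 * T2 - T3 + s * T4 - r * / (m ^ 2 * (m + 1))).
  2:{ unfold T1, T2, T3, T4, s, r, n. field. lra. }
  assert (H5 : Rabs (r * / (m ^ 2 * (m + 1))) <= Rabs r / m ^ 3).
  { assert (0 < m ^ 3) by (apply pow_lt; lra). assert (0 < m ^ 2) by (apply pow_lt; lra).
    rewrite Rabs_mult. apply Rmult_le_compat_l; [apply Rabs_pos|].
    assert (0 < m ^ 2 * (m + 1)) by (apply Rmult_lt_0_compat; lra).
    rewrite Rabs_right by (left; now apply Rinv_0_lt_compat).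
    apply Rinv_le_contravar; auto. simpl. nra. }
  assert (H4 : Rabs (s * T4) <= Rabs s * K4 / m ^ 3).
  { rewrite Rabs_mult. unfold Rdiv. rewrite Rmult_assoc. apply Rmult_le_compat_l; [apply Rabs_pos|auto]. }
  apply Rabs_le_between in S1, S2, S3, H4, H5.
  unfold K, Rdiv in *. rewrite !Rmult_plus_distr_r, (Rmult_assoc _ K1), (Rmult_assoc _ K2).
  apply Rabs_le. lra. }
exists (M + (Rabs r + M / n) ^ 2 * exp ((Rabs r + M / n) / n)). split.
{ apply Rplus_le_le_0_compat; auto. apply Rmult_le_pos; [apply pow2_ge_0|left; apply exp_pos]. }
intros j. assert (Hj := pos_INR j). set (m := n + INR j).
assert (Hm : n <= m) by (unfold m; lra).
exists (exp (L j) - 1 - r / m). split.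
- apply (exp_second_order n r M (L j) (L j - r * / m)); auto. unfold Rdiv. ring.
- replace (1 + r / m + (exp (L j) - 1 - r / m)) with (exp (L j)) by ring.
  unfold Rpower. rewrite <- exp_plus.
  assert (G1 : INR (fact (k + j)) = RGamma (INR k + 1 + INR j)).
  { rewrite <- RGamma_INR, plus_INR. f_equal. ring. }
  assert (G2 : INR (fact (i + j)) = RGamma (INR i + 1 + INR j)).
  { rewrite <- RGamma_INR, plus_INR. f_equal. ring. }
  rewrite G1, G2.
  assert (Q1 := RGamma_pos (INR k + 1 + INR j) ltac:(lra)).
  assert (Q2 := RGamma_pos (al + 1 + INR k + INR j) ltac:(lra)).
  assert (Q3 := RGamma_pos (INR i + 1 + INR j) ltac:(lra)).
  replace ((n - INR i - / 2) * ln m + L j) with (/ 2 * lam (INR k + 1) j + / 2 * lam (al + 1 + INR k) j + - lam (INR i + 1) j).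
  2:{ unfold L. fold m. ring. }
  rewrite !exp_plus, exp_Ropp. unfold lam.
  rewrite (exp_ln (RGamma (INR i + 1 + INR j))) by auto.
  rewrite sqrt_mult by lra. rewrite <- !Rpower_sqrt by auto. reflexivity.
Qed.

(** * The uniform estimate *)

(* [Binomial.C k i * rpoch b i] for [i <= k], and [0] for [k < i]; [Binomial.C k i] itself
   does not vanish for [k < i]. *)
Definition bcoef (k : nat) (b : R) (i : nat) : R :=
  (-1) ^ i * rpoch (- INR k) i / INR (fact i) * rpoch b i.

Lemma bcoef_succ (k : nat) (b : R) (i : nat) :
  INR (S i) * bcoef k b (S i) = (INR k - INR i) * (b + INR i) * bcoef k b i.
Proof.
unfold bcoef. rewrite fact_simpl, mult_INR, S_INR. simpl.
assert (F := INR_fact_lt_0 i). assert (P := pos_INR i). field. lra.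
Qed.

Lemma binomial_rpoch (k i : nat) : (i <= k)%nat ->
  Binomial.C k i = (-1) ^ i * rpoch (- INR k) i / INR (fact i).
Proof.
intros Hi. unfold Binomial.C.
assert (E : (-1) ^ i * rpoch (- INR k) i * INR (fact (k - i)) = INR (fact k)).
{ induction i as [|i IH].
  - simpl. rewrite Nat.sub_0_r. ring.
  - rewrite <- IH by lia. replace (k - i)%nat with (S (k - S i)) by lia.
    rewrite fact_simpl, mult_INR. replace (S (k - S i)) with (k - i)%nat by lia.
    rewrite minus_INR by lia. simpl. ring. }
rewrite <- E. field. split; apply INR_fact_neq_0.
Qed.

Lemma bcoef_telescope (al z : R) (k : nat) : 0 < z ->
  let n := (al + 1) / 2 + INR k in
  sum_f_R0 (fun i => bcoef k (- (al + INR k)) i * Rpower z (n - INR i) *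
    (- ((INR k - INR i) * (al + INR k - INR i)) / 2 - INR i * z / 2)) k = 0.
Proof.
intros Hz n. set (b := - (al + INR k)).
(* The part [- i * z / 2] of each term cancels the other part of the preceding one, since both carry
   the same power of [z]. What remains at [N] is a multiple of [(k - N) * bcoef k b N], which is 0
   at [N = k]. *)
assert (H : forall N, sum_f_R0 (fun i => bcoef k b i * Rpower z (n - INR i) *
    (- ((INR k - INR i) * (al + INR k - INR i)) / 2 - INR i * z / 2)) N =
    / 2 * (INR (S N) * bcoef k b (S N)) * Rpower z (n - INR N)).
{ intros N. induction N as [|N IH].
  - rewrite bcoef_succ. unfold b. simpl. field.
  - rewrite tech5, IH, (bcoef_succ k b (S N)).
    replace (Rpower z (n - INR N)) with (z * Rpower z (n - INR (S N))).
    2:{ rewrite <- (Rpower_1 z) at 1 by auto. rewrite <- Rpower_plus. f_equal. rewrite S_INR. ring. }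
    unfold b. field. }
rewrite H, bcoef_succ. ring.
Qed.

Lemma one_minus_pow_bounds (y : R) (i : nat) : 0 <= y <= 1 ->
  0 <= (1 - y) ^ i - 1 + INR i * y <= INR i ^ 2 * y ^ 2.
Proof.
intros Hy. induction i as [|i IH].
- simpl. lra.
- rewrite S_INR. simpl ((1 - y) ^ S i).
  set (e := (1 - y) ^ i - 1 + INR i * y) in IH.
  replace ((1 - y) * (1 - y) ^ i - 1 + (INR i + 1) * y) with ((1 - y) * e + INR i * y ^ 2) by (unfold e; ring).
  assert (Hi := pos_INR i). assert (0 <= y ^ 2) by nra.
  assert (0 <= INR i * y ^ 2) by (apply Rmult_le_pos; lra).
  assert (0 <= (1 - y) * e) by (apply Rmult_le_pos; lra).
  assert ((1 - y) * e <= e) by nra.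
  split; nra.
Qed.

(** With [z = 2 * m * y], the unit [(1 + z) ^ 3 / m ^ 2] dominates [1 / m ^ 2], [y / m], [y ^ 2] and
    [y ^ 2 * (1 + m * y)]. The four summands of the constant belong to [eps], to [dl], to the
    quadratic error of [(1 - y) ^ i] and to the cross term [r * i * y / m]. *)
Lemma product_expansion (n r K1 K2 : R) (i : nat) : 0 < n -> 0 <= K1 -> 0 <= K2 ->
  exists K, 0 <= K /\ forall m y dl eps, n <= m -> 0 <= y <= 1 ->
  Rabs dl <= K1 / m ^ 2 -> Rabs eps <= K2 * (y ^ 2 * (1 + m * y)) ->
  Rabs ((1 + r / m + dl) * (1 - y) ^ i * (1 + eps) - (1 + r / m - INR i * y)) <= K * ((1 + 2 * m * y) ^ 3 / m ^ 2).
Proof.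
intros Hn HK1 HK2.
assert (Pi := pos_INR i). assert (Pr := Rabs_pos r).
assert (In : 0 < / n) by now apply Rinv_0_lt_compat.
assert (A1 : 0 <= Rabs r / n) by (apply Rmult_le_pos; lra).
assert (A2 : 0 <= K1 / n ^ 2) by (apply Rmult_le_pos; [lra|left; apply Rinv_0_lt_compat, pow_lt; lra]).
exists ((1 + Rabs r / n + K1 / n ^ 2) * K2 + K1 + (1 + Rabs r / n) * INR i ^ 2 + Rabs r * INR i).
split.
{ assert (0 <= INR i ^ 2) by nra. repeat apply Rplus_le_le_0_compat; try apply Rmult_le_pos; lra. }
intros m y dl eps Hm Hy Hdl Heps.
assert (Im : 0 < / m) by (apply Rinv_0_lt_compat; lra).
assert (Imn : / m <= / n) by (apply Rinv_le_contravar; lra).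
assert (P2 : 0 < m ^ 2) by (apply pow_lt; lra).
assert (Im2 : 0 < / m ^ 2) by now apply Rinv_0_lt_compat.
assert (Imn2 : / m ^ 2 <= / n ^ 2).
{ apply Rinv_le_contravar; [apply pow_lt; lra|apply pow_incr; lra]. }
set (z := 2 * m * y). assert (Hz : 0 <= z) by (unfold z; apply Rmult_le_pos; lra).
set (w := (1 + z) ^ 3 / m ^ 2).
assert (Hw : forall s, s <= (1 + z) ^ 3 -> s / m ^ 2 <= w) by (intros s Hs; apply Rmult_le_compat_r; lra).
assert (z2 : 0 <= z ^ 2) by nra. assert (z3 : 0 <= z ^ 3) by (apply pow_le; auto).
assert (E3 : (1 + z) ^ 3 = 1 + 3 * z + 3 * z ^ 2 + z ^ 3) by ring.
assert (w1 : 1 / m ^ 2 <= w) by (apply Hw; lra).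
assert (w2 : y / m <= w).
{ replace (y / m) with (z / 2 / m ^ 2) by (unfold z; field; lra). apply Hw; lra. }
assert (w3 : y ^ 2 <= w).
{ replace (y ^ 2) with (z ^ 2 / 4 / m ^ 2) by (unfold z; field; lra). apply Hw; lra. }
assert (w4 : y ^ 2 * (1 + m * y) <= w).
{ replace (y ^ 2 * (1 + m * y)) with ((z ^ 2 / 4 + z ^ 3 / 8) / m ^ 2) by (unfold z; field; lra). apply Hw; lra. }
assert (w0 : 0 <= w) by (unfold w; apply Rmult_le_pos; lra).
assert (Hrm : Rabs (r / m) <= Rabs r / n).
{ unfold Rdiv. rewrite Rabs_mult, (Rabs_right (/ m)) by lra. apply Rmult_le_compat_l; lra. }
assert (Hdl' : Rabs dl <= K1 / n ^ 2).
{ apply Rle_trans with (1 := Hdl). apply Rmult_le_compat_l; lra. }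
assert (Hdlw : Rabs dl <= K1 * w).
{ apply Rle_trans with (1 := Hdl). replace (K1 / m ^ 2) with (K1 * (1 / m ^ 2)) by (field; lra). apply Rmult_le_compat_l; lra. }
assert (Hepsw : Rabs eps <= K2 * w).
{ apply Rle_trans with (1 := Heps). apply Rmult_le_compat_l; lra. }
assert (B := one_minus_pow_bounds y i Hy).
set (q := (1 - y) ^ i) in *. set (e := q - 1 + INR i * y) in B.
assert (Hq : 0 <= q <= 1).
{ split; [apply pow_le; lra|]. rewrite <- (pow1 i). apply pow_incr. lra. }
assert (He : Rabs e <= INR i ^ 2 * w).
{ rewrite Rabs_right by lra. apply Rle_trans with (1 := proj2 B). apply Rmult_le_compat_l; nra. }
replace ((1 + r / m + dl) * q * (1 + eps) - (1 + r / m - INR i * y))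
  with ((1 + r / m + dl) * q * eps + dl * q + (1 + r / m) * e + - (r * INR i * (y / m))).
2:{ unfold e. field. lra. }
assert (X1 : Rabs ((1 + r / m + dl) * q * eps) <= (1 + Rabs r / n + K1 / n ^ 2) * K2 * w).
{ rewrite !Rabs_mult, (Rabs_right q) by lra. rewrite Rmult_assoc.
  rewrite (Rmult_assoc _ K2).
  apply Rmult_le_compat; [apply Rabs_pos| | |].
  - apply Rmult_le_pos; [lra|apply Rabs_pos].
  - apply Rle_trans with (1 := Rabs_triang _ _). apply Rplus_le_compat; auto.
    apply Rle_trans with (1 := Rabs_triang _ _). rewrite Rabs_R1. lra.
  - rewrite <- (Rmult_1_l (K2 * w)). apply Rmult_le_compat; try lra. apply Rabs_pos. }
assert (X2 : Rabs (dl * q) <= K1 * w).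
{ rewrite Rabs_mult, (Rabs_right q) by lra. assert (T := Rabs_pos dl). nra. }
assert (X3 : Rabs ((1 + r / m) * e) <= (1 + Rabs r / n) * INR i ^ 2 * w).
{ rewrite Rabs_mult, Rmult_assoc. apply Rmult_le_compat; try apply Rabs_pos; auto.
  apply Rle_trans with (1 := Rabs_triang _ _). rewrite Rabs_R1. lra. }
assert (X4 : Rabs (- (r * INR i * (y / m))) <= Rabs r * INR i * w).
{ rewrite Rabs_Ropp, !Rabs_mult, (Rabs_right (INR i)), (Rabs_right (y / m)).
  - apply Rmult_le_compat_l; [apply Rmult_le_pos|]; lra.
  - apply Rle_ge, Rmult_le_pos; lra.
  - lra. }
eapply Rle_trans; [apply Rabs_triang|]. eapply Rle_trans; [apply Rplus_le_compat_r, Rabs_triang|].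
eapply Rle_trans; [apply Rplus_le_compat_r, Rplus_le_compat_r, Rabs_triang|]. lra.
Qed.

(** A factor [sqrt z] is kept outside because the weight [sqrt x] of the theorem needs it; the
    remaining exponent [p - / 2] is nonnegative, so the exponential bounds the rest near 0 as well
    as at infinity. *)
Lemma Rpower_pow_exp_le_sqrt (p : R) : / 2 <= p ->
  exists K, 0 <= K /\ forall z, 0 < z -> Rpower z p * (1 + z) ^ 3 * exp (- (z / 2)) <= K * sqrt z.
Proof.
intros Hp. destruct (Rpower_le_pow (p - / 2) ltac:(lra)) as [N HN].
destruct (pow_exp_bounded (N + 3) (/ 2) ltac:(lra)) as (K & HK & H).
exists K. split; [lra|]. intros z Hz.
replace p with (/ 2 + (p - / 2)) by ring. rewrite Rpower_plus, Rpower_sqrt by auto.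
specialize (HN z Hz). specialize (H z ltac:(lra)). rewrite pow_add in H.
replace (- (z / 2)) with (- (/ 2 * z)) by field.
set (E := exp _) in *. assert (0 < E) by apply exp_pos.
assert (0 < sqrt z) by now apply sqrt_lt_R0.
assert (0 < (1 + z) ^ 3) by (apply pow_lt; lra).
replace (sqrt z * Rpower z (p - / 2) * (1 + z) ^ 3 * E) with (Rpower z (p - / 2) * ((1 + z) ^ 3 * E) * sqrt z) by ring.
apply Rmult_le_compat_r; [lra|]. apply Rle_trans with (2 := H). rewrite Rmult_assoc.
apply Rmult_le_compat_r; auto. apply Rmult_le_pos; lra.
Qed.

Lemma sum_f_R0_error {T : Type} (P : T -> Prop) (f g : nat -> T -> R) (w : T -> R) (k : nat) :
  (forall i, (i <= k)%nat -> exists K, 0 <= K /\ forall t, P t -> Rabs (f i t - g i t) <= K * w t) ->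
  exists K, 0 <= K /\ forall t, P t ->
    Rabs (sum_f_R0 (fun i => f i t) k - sum_f_R0 (fun i => g i t) k) <= K * w t.
Proof.
induction k as [|k IH]; intros H.
- simpl. apply H. lia.
- destruct IH as (K1 & HK1 & H1); [intros i Hi; apply H; lia|].
  destruct (H (S k) ltac:(lia)) as (K2 & HK2 & H2).
  exists (K1 + K2). split; [lra|]. intros t Ht. simpl.
  replace (sum_f_R0 (fun i => f i t) k + f (S k) t - (sum_f_R0 (fun i => g i t) k + g (S k) t))
    with ((sum_f_R0 (fun i => f i t) k - sum_f_R0 (fun i => g i t) k) + (f (S k) t - g (S k) t)) by ring.
  apply Rle_trans with (1 := Rabs_triang _ _). rewrite Rmult_plus_distr_r.
  apply Rplus_le_compat; auto.
Qed.

Lemma term_estimate (al : R) (k i : nat) : 0 <= al -> (i <= k)%nat ->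
  let n := (al + 1) / 2 + INR k in
  let r := - ((INR k - INR i) * (al + INR k - INR i)) / 2 in
  exists K, 0 <= K /\ forall (j : nat) (x : R), 1 <= x ->
  let m := n + INR j in let z := 2 * m / x in
  Rabs (sqrt (INR (fact (k + j)) * RGamma (al + 1 + INR k + INR j)) / INR (fact (i + j)) *
     (Rpow0 ((x - 1) / 2) (INR j / 2) * Rpow0 ((x + 1) / 2) (- (n + INR j / 2))) * ((x - 1) / 2) ^ i
   - / sqrt m * exp (- (z / 2)) * Rpower z (n - INR i) * (1 + r / m - INR i * (/ x)))
  <= K * (/ sqrt m * sqrt z / m ^ 2).
Proof.
intros Hal Hi n r.
assert (Pk := pos_INR k). assert (Pi := pos_INR i). assert (Hn : 0 < n) by (unfold n; lra).
apply le_INR in Hi.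
destruct (Gamma_ratio_asymp al k i Hal) as (K1 & HK1 & H1).
destruct (prefactor_asymp n Hn) as (K2 & HK2 & H2).
destruct (product_expansion n r K1 K2 i Hn HK1 ltac:(lra)) as (K3 & HK3 & H3).
destruct (Rpower_pow_exp_le_sqrt (n - INR i) ltac:(unfold n; lra)) as (K4 & HK4 & H4).
exists (K3 * K4). split; [apply Rmult_le_pos; auto|].
intros j x Hx m z. assert (Pj := pos_INR j).
destruct (H1 j) as (dl & Hdl & ->). destruct (H2 j x Hx) as (eps & Heps & ->).
fold n r. fold m.  fold n m r in Hdl. fold m in Heps.
set (y := / x) in *.
assert (Hy : 0 < y <= 1).
{ split; [apply Rinv_0_lt_compat; lra|]. rewrite <- Rinv_1. apply Rinv_le_contravar; lra. }
assert (Hm : n <= m) by (unfold m; lra).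
assert (Ez : z = 2 * m * y) by reflexivity.
assert (Hz : 0 < z) by (rewrite Ez; repeat apply Rmult_lt_0_compat; lra).
specialize (H3 m y dl eps Hm ltac:(lra) Hdl Heps). rewrite <- Ez in H3.
specialize (H4 z Hz).
assert (Sm : 0 < sqrt m) by (apply sqrt_lt_R0; lra).
assert (E0 : ((x - 1) / 2) ^ i = Rpower (2 / x) (- INR i) * (1 - y) ^ i).
{ rewrite Rpower_Ropp, Rpower_pow, <- pow_inv, <- Rpow_mult_distr by (apply Rdiv_lt_0_compat; lra).
  f_equal. unfold y. field. lra. }
(* The power of [m] from the Gamma quotient and the powers of [2 / x] from the prefactor and from
   the hypergeometric variable combine into a power of [z = m * (2 / x)]. *)
assert (E1 : Rpower m (n - INR i - / 2) * Rpower (2 / x) n * Rpower (2 / x) (- INR i) = / sqrt m * Rpower z (n - INR i)).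
{ rewrite Rmult_assoc, <- Rpower_plus.
  replace (n - INR i - / 2) with ((n - INR i) + - / 2) by ring. rewrite Rpower_plus, Rpower_Ropp, Rpower_sqrt by lra.
  replace z with (m * (2 / x)) by (unfold z; field; lra).
  rewrite <- Rpower_mult_distr by (try apply Rdiv_lt_0_compat; lra). unfold Rminus. ring. }
assert (E2 : exp (- (m / x)) = exp (- (z / 2))) by (do 2 f_equal; unfold z; field; lra).
rewrite E0, E2.
set (A := 1 + r / m + dl) in *. set (EX := exp (- (z / 2))) in *.
replace (Rpower m (n - INR i - / 2) * A * (Rpower (2 / x) n * EX * (1 + eps)) * (Rpower (2 / x) (- INR i) * (1 - y) ^ i)
   - / sqrt m * EX * Rpower z (n - INR i) * (1 + r / m - INR i * y))
  with (/ sqrt m * Rpower z (n - INR i) * EX * (A * (1 - y) ^ i * (1 + eps) - (1 + r / m - INR i * y))).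
2:{ replace (/ sqrt m * EX * Rpower z (n - INR i)) with (/ sqrt m * Rpower z (n - INR i) * EX) by ring.
    rewrite <- E1. ring. }
assert (PE : 0 < EX) by apply exp_pos. assert (PR : 0 < Rpower z (n - INR i)) by apply exp_pos.
assert (PS : 0 < / sqrt m) by now apply Rinv_0_lt_compat.
assert (PM : 0 < / m ^ 2) by (apply Rinv_0_lt_compat, pow_lt; lra).
rewrite Rabs_mult, (Rabs_right (/ sqrt m * _ * _)) by (left; repeat apply Rmult_lt_0_compat; auto).
apply Rle_trans with (/ sqrt m * Rpower z (n - INR i) * EX * (K3 * ((1 + z) ^ 3 / m ^ 2))).
{ apply Rmult_le_compat_l; auto. left; repeat apply Rmult_lt_0_compat; auto. }
replace (/ sqrt m * Rpower z (n - INR i) * EX * (K3 * ((1 + z) ^ 3 / m ^ 2)))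
  with ((/ sqrt m * / m ^ 2 * K3) * (Rpower z (n - INR i) * (1 + z) ^ 3 * EX)) by (unfold Rdiv; ring).
replace (K3 * K4 * (/ sqrt m * sqrt z / m ^ 2)) with ((/ sqrt m * / m ^ 2 * K3) * (K4 * sqrt z)) by (unfold Rdiv; ring).
apply Rmult_le_compat_l; auto. apply Rmult_le_pos; auto. left; apply Rmult_lt_0_compat; auto.
Qed.

(* The terms of order [1 / m] cancel by [bcoef_telescope]. *)
Lemma sum_estimate (al : R) (k : nat) : 0 <= al ->
  let n := (al + 1) / 2 + INR k in
  exists K, 0 <= K /\ forall (j : nat) (x : R), 1 <= x ->
  let m := n + INR j in let z := 2 * m / x in
  Rabs (sum_f_R0 (fun i => bcoef k (- (al + INR k)) i *
    (sqrt (INR (fact (k + j)) * RGamma (al + 1 + INR k + INR j)) / INR (fact (i + j)) *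
     (Rpow0 ((x - 1) / 2) (INR j / 2) * Rpow0 ((x + 1) / 2) (- (n + INR j / 2))) * ((x - 1) / 2) ^ i)) k
   - / sqrt m * exp (- (z / 2)) * sum_f_R0 (fun i => bcoef k (- (al + INR k)) i * Rpower z (n - INR i)) k)
  <= K * (/ sqrt m * sqrt z / m ^ 2).
Proof.
intros Hal n. assert (Pk := pos_INR k). assert (Hn : 0 < n) by (unfold n; lra).
set (b := - (al + INR k)).
pose (rr := fun i : nat => - ((INR k - INR i) * (al + INR k - INR i)) / 2).
destruct (sum_f_R0_error (fun t : nat * R => 1 <= snd t)
  (fun i t => let (j, x) := t in bcoef k b i *
    (sqrt (INR (fact (k + j)) * RGamma (al + 1 + INR k + INR j)) / INR (fact (i + j)) *
     (Rpow0 ((x - 1) / 2) (INR j / 2) * Rpow0 ((x + 1) / 2) (- (n + INR j / 2))) * ((x - 1) / 2) ^ i))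
  (fun i t => let (j, x) := t in let m := n + INR j in let z := 2 * m / x in bcoef k b i *
    (/ sqrt m * exp (- (z / 2)) * Rpower z (n - INR i) * (1 + rr i / m - INR i * (/ x))))
  (fun t => let (j, x) := t in let m := n + INR j in let z := 2 * m / x in / sqrt m * sqrt z / m ^ 2) k)
  as (K & HK & H).
{ intros i Hi. destruct (term_estimate al k i Hal Hi) as (K & HK & H).
  exists (Rabs (bcoef k b i) * K). split; [apply Rmult_le_pos; [apply Rabs_pos|auto]|].
  intros [j x] Hx. rewrite <- Rmult_minus_distr_l, Rabs_mult, (Rmult_assoc (Rabs (bcoef k b i))).
  apply Rmult_le_compat_l; [apply Rabs_pos|]. apply H. exact Hx. }
exists K. split; auto. intros j x Hx m z. specialize (H (j, x) Hx). cbv beta iota zeta in H.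
fold m in H. fold z in H.
assert (Pj := pos_INR j). assert (Hm : 0 < m) by (unfold m; lra).
assert (Hz : 0 < z) by (unfold z; apply Rdiv_lt_0_compat; lra).
assert (Tel := bcoef_telescope al z k Hz). cbv zeta in Tel. fold n b in Tel.
replace (/ sqrt m * exp (- (z / 2)) * sum_f_R0 (fun i => bcoef k b i * Rpower z (n - INR i)) k)
  with (sum_f_R0 (fun i => bcoef k b i * (/ sqrt m * exp (- (z / 2)) * Rpower z (n - INR i) * (1 + rr i / m - INR i * (/ x)))) k).
{ exact H. }
(* Zero is added in the form of the telescoping sum times the common factor over [m]; with
   [/ x = z / (2 * m)] its terms are exactly the corrections [rr i / m - i / x]. *)
rewrite <- (Rplus_0_r (_ * _ * sum_f_R0 _ _)), <- (Rmult_0_r (/ sqrt m * exp (- (z / 2)) / m)), <- Tel.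
rewrite !scal_sum, <- plus_sum. apply sum_eq. intros i _. unfold rr.
replace (/ x) with (z / (2 * m)) by (unfold z; field; lra). field.
split; [apply Rgt_not_eq, sqrt_lt_R0; lra|lra].
Qed.

(** * Both functions in real form, and the conclusion *)

Lemma Cffact_RtoC (a : R) (j : nat) : Cffact (RtoC a) j = RtoC ((-1) ^ j * rpoch (- a) j).
Proof.
induction j as [|j IH]; simpl; [f_equal; ring|]. rewrite IH, <- RtoC_minus, <- RtoC_mult. f_equal. ring.
Qed.

Lemma rpoch_fact (j i : nat) : rpoch (INR j + 1) i * INR (fact j) = INR (fact (i + j)).
Proof.
induction i as [|i IH]; [simpl; ring|].
change (S i + j)%nat with (S (i + j)). rewrite fact_simpl, mult_INR, <- IH, S_INR, plus_INR. simpl. ring.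
Qed.

(** The binomial is [(-1) ^ j * rpoch (n - l) j / j!], while [RGamma (n - l + j) = rpoch (n - l) j *
    RGamma (n - l)] is in the denominator under the root; their product leaves this Gamma value
    under a root in the numerator. The sign of [((1 - x) / 2) ^ i] goes into [bcoef], and
    [j! * rpoch (j + 1) i] is [(i + j)!]. *)
Lemma calP_real (l n x : R) (k j : nat) : l <= - (1 / 2) -> n = - l + INR k -> 1 <= x ->
  calP l n j x = RtoC ((-1) ^ j / sqrt (INR (fact k) * RGamma (n - l)) *
    sum_f_R0 (fun i => bcoef k (- (-2 * l - 1 + INR k)) i *
    (sqrt (INR (fact (k + j)) * RGamma (-2 * l - 1 + 1 + INR k + INR j)) / INR (fact (i + j)) *
     (Rpow0 ((x - 1) / 2) (INR j / 2) * Rpow0 ((x + 1) / 2) (- (n + INR j / 2))) * ((x - 1) / 2) ^ i)) k).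
Proof.
intros Hl Hn Hx. assert (Pk := pos_INR k). assert (Pj := pos_INR j).
unfold calP, frakP. unfold Cbinom.
rewrite <- RtoC_opp, <- !RtoC_minus, <- RtoC_plus, <- RtoC_minus, Cffact_RtoC.
replace (- l - n) with (- INR k) by lra.
rewrite hyp2F1_terminating by lra.
rewrite <- RtoC_div by apply INR_fact_neq_0. rewrite <- !RtoC_mult. f_equal.
replace (n + INR j - n) with (INR j) by ring.
replace ((n + INR j + n) / 2) with (n + INR j / 2) by field.
replace (- (l - n)) with (n - l) by ring.
replace (- l + n) with (n - l) by ring.
replace (- l + (n + INR j)) with (n - l + INR j) by ring.
replace (l + (n + INR j) + 1) with (INR (k + j) + 1) by (rewrite plus_INR; lra).
replace (l + n + 1) with (INR k + 1) by lra.
replace (-2 * l - 1 + 1 + INR k + INR j) with (n - l + INR j) by lra.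
replace (l + 1 - n) with (- (-2 * l - 1 + INR k)) by lra.
rewrite !RGamma_INR, RGamma_plus_INR by lra.
set (X1 := Rpow0 ((x - 1) / 2) _). set (X2 := Rpow0 ((x + 1) / 2) _).
set (b := - (-2 * l - 1 + INR k)).
assert (Pg := RGamma_pos (n - l) ltac:(lra)). assert (Pp := rpoch_pos (n - l) j ltac:(lra)).
assert (PA := INR_fact_lt_0 (k + j)). assert (PB := INR_fact_lt_0 k). assert (PF := INR_fact_lt_0 j).
set (g := RGamma (n - l)) in *. set (p := rpoch (n - l) j) in *.
set (A := INR (fact (k + j))) in *. set (B := INR (fact k)) in *.
rewrite sqrt_div, !sqrt_mult by (repeat (apply Rmult_lt_0_compat || apply Rmult_le_pos); lra).
assert (Sg := sqrt_lt_R0 g Pg). assert (Sp := sqrt_lt_R0 p Pp). assert (SA := sqrt_lt_R0 A PA). assert (SB := sqrt_lt_R0 B PB).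
rewrite scal_sum. rewrite Rmult_comm, Rmult_assoc, Rmult_comm, scal_sum.
rewrite !scal_sum. apply sum_eq. intros i Hi. unfold bcoef.
assert (Q := rpoch_pos (INR j + 1) i ltac:(lra)).
rewrite <- rpoch_fact.
replace ((1 - x) / 2) with (-1 * ((x - 1) / 2)) by field. rewrite Rpow_mult_distr.
replace p with (sqrt p * sqrt p) at 1 by (apply sqrt_sqrt; lra).
field. repeat split; try (apply Rgt_not_eq; assumption). apply INR_fact_neq_0.
Qed.

(** The value of [t] here is [l + 1 - n], the second hypergeometric parameter in [frakP]; hence the
    common coefficients [bcoef]. *)
Lemma Whittaker_real (W : C -> C -> C -> C) (l n z : R) (k : nat) :
  is_Whittaker W -> n = - l + INR k -> 0 < z ->
  W (RtoC n) (RtoC (l + 1 / 2)) (RtoC z) =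
  RtoC (exp (- (z / 2)) * sum_f_R0 (fun i => bcoef k (- (-2 * l - 1 + INR k)) i * Rpower z (n - INR i)) k).
Proof.
intros HW Hn Hz.
assert (E := Whittaker_elementary W k (- (-2 * l - 1 + INR k)) z HW Hz).
replace ((INR k + 1 - - (-2 * l - 1 + INR k)) / 2) with n in E by lra.
replace ((- (-2 * l - 1 + INR k) + INR k) / 2) with (l + 1 / 2) in E by lra.
rewrite E. f_equal. rewrite (Rmult_comm (Rpower z n)), Rmult_assoc. f_equal.
rewrite scal_sum. apply sum_eq. intros i Hi.
unfold bcoef. rewrite <- binomial_rpoch by auto.
replace (n - INR i) with (n + - INR i) by ring. rewrite Rpower_plus, Rpower_Ropp, Rpower_pow by auto. unfold Rdiv. ring.
Qed.

Theorem theorem1p8 (W : C -> C -> C -> C) (l n : R) (k : nat)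
    (hW : is_Whittaker W)
    (hl : l <= - (1 / 2))
    (hn : n = - l + INR k) :
  is_finite (Lub_Rbar (fun y : R =>
    exists (x : R) (m : R) (j : nat), 1 <= x /\ m = n + INR j /\
      y = Cmod (calP l n j x
                - RtoC ((-1) ^ j / sqrt (m * INR (fact k) * RGamma (n - l)))
                  * W (RtoC n) (RtoC (l + 1 / 2)) (RtoC (2 * m / x)))%C
          * sqrt x * m ^ 2)).
Proof.
set (E := fun y : R => _).
assert (Pk := pos_INR k).
destruct (sum_estimate (-2 * l - 1) k ltac:(lra)) as (K & HK & H).
assert (En : (-2 * l - 1 + 1) / 2 + INR k = n) by lra. rewrite En in H. cbv zeta in H.
assert (Pg := RGamma_pos (n - l) ltac:(lra)). assert (PF := INR_fact_lt_0 k).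
set (N0 := sqrt (INR (fact k) * RGamma (n - l))).
assert (PN : 0 < N0) by (apply sqrt_lt_R0, Rmult_lt_0_compat; auto).
assert (HB : forall y, E y -> y <= / N0 * K * sqrt 2).
{ intros y (x & m & j & Hx & Hm & ->).
  assert (Pj := pos_INR j). assert (Pm : 0 < m) by lra.
  assert (Pz : 0 < 2 * m / x) by (apply Rdiv_lt_0_compat; lra).
  specialize (H j x Hx). rewrite <- Hm in H.
  rewrite (calP_real l n x k j hl hn Hx), (Whittaker_real W l n (2 * m / x) k hW hn Pz).
  fold N0. match type of H with Rabs (?a - _ * _ * ?b) <= _ => set (S1 := a) in *; set (S2 := b) in * end.
  set (EX := exp (- (2 * m / x / 2))) in *.
  rewrite <- RtoC_mult, <- RtoC_minus, Cmod_R.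
  replace (sqrt (m * INR (fact k) * RGamma (n - l))) with (sqrt m * N0).
  2:{ unfold N0. rewrite (Rmult_assoc m). symmetry. apply sqrt_mult; [lra|apply Rmult_le_pos; lra]. }
  assert (Sm := sqrt_lt_R0 m Pm).
  replace ((-1) ^ j / N0 * S1 - (-1) ^ j / (sqrt m * N0) * (EX * S2)) with ((-1) ^ j * (/ N0 * (S1 - / sqrt m * EX * S2))) by (field; lra).
  rewrite Rabs_mult, pow_1_abs, Rmult_1_l, Rabs_mult, (Rabs_right (/ N0)) by (left; now apply Rinv_0_lt_compat).
  assert (PI : 0 < / N0) by now apply Rinv_0_lt_compat.
  assert (Sx : 0 < sqrt x) by (apply sqrt_lt_R0; lra).
  assert (P2 : 0 < m ^ 2) by (apply pow_lt; lra).
  (* The weights balance here: [sqrt x] frees [sqrt z] from [x], and the resulting [sqrt m] cancels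
     [/ sqrt m]. *)
  assert (EQ : sqrt (2 * m / x) * sqrt x = sqrt 2 * sqrt m).
  { rewrite <- !sqrt_mult by lra. f_equal. field. lra. }
  apply Rle_trans with (/ N0 * (K * (/ sqrt m * sqrt (2 * m / x) / m ^ 2)) * sqrt x * m ^ 2).
  { repeat (apply Rmult_le_compat_r; [lra|]). apply Rmult_le_compat_l; [lra|exact H]. }
  right. replace (/ N0 * (K * (/ sqrt m * sqrt (2 * m / x) / m ^ 2)) * sqrt x * m ^ 2)
    with (/ N0 * K * / sqrt m * (sqrt (2 * m / x) * sqrt x)) by (field; lra).
  rewrite EQ. field. lra. }
(* The bound [HB] excludes the value [p_infty]; the element at [x = 1], [m = n] excludes [m_infty],
   the supremum of the empty set. *)
assert (L := Lub_Rbar_correct E). destruct L as [L1 L2].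
assert (HE : E (Cmod (calP l n 0 1 - RtoC ((-1) ^ 0 / sqrt (n * INR (fact k) * RGamma (n - l)))
   * W (RtoC n) (RtoC (l + 1 / 2)) (RtoC (2 * n / 1)))%C * sqrt 1 * n ^ 2)).
{ exists 1, n, 0%nat. split; [lra|]. split; [simpl; ring|reflexivity]. }
specialize (L1 _ HE). specialize (L2 (Finite (/ N0 * K * sqrt 2)) HB).
destruct (Lub_Rbar E); [reflexivity|destruct L2|destruct L1].
Qed.
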